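(* Let $\psi\colon\{2,3,4,\ldots\}\to\mathbb R$ be an arithmetic function (i.e. a non-constant function) such that $\liminf_{n\to\infty}\psi(n)\geq0$ and $\limsup_{n\to\infty}\psi(n)=\infty$. Then $I_{\psi\circ b_1}(\alpha)=0$ holds for every $\alpha\in[\psi(2),\infty)$ if and only if $$\limsup_{n\to\infty}\frac{\psi(n)}{\log n}=\infty.$$
   Context: The R\'enyi map $T\colon[0,1)\to[0,1)$ is $Tx=\frac{1}{1-x}-\left\lfloor\frac{1}{1-x}\right\rfloor$, and $b_1(x)=\left\lfloor\frac{1}{1-x}\right\rfloor+1\geq2$ is the first digit of the backward continued fraction expansion of $x\in[0,1)$. $\mathcal M(T)$ is the set of $T$-invariant Borel probability measures on $[0,1)$; $\phi=-\log T'$ (where $T'(x)=(1-x)^{-2}$, one-sided derivative at branch endpoints); $\mathcal M_\phi(T)$ is the set of $\mu\in\mathcal M(T)$ for which $\phi$ is $\mu$-integrable. For $\mu\in\mathcal M_\phi(T)$, $\chi(\mu)=-\int\phi\,d\mu\geq0$, $h(\mu)$ is the Kolmogorov-Sinai entropy of $\mu$ with respect to $T$, and $F(\mu)=h(\mu)-\chi(\mu)$. The rate function $I_{\psi\circ b_1}\colon\mathbb R\to[0,\infty]$ is $$I_{\psi\circ b_1}(\alpha)=-\lim_{\epsilon\to0}\sup\left\{F(\mu)\colon\mu\in\mathcal M_\phi(T),\ \psi\circ b_1\in L^1(\mu),\ \int \psi\circ b_1\,d\mu\in(\alpha-\epsilon,\alpha+\epsilon)\right\},$$ with $\sup\emptyset=-\infty$.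 *)

(* Defs.v *)
From HB Require Import structures.
From mathcomp Require Import all_boot all_order all_algebra.
From mathcomp Require Import all_classical all_reals all_analysis.
From mathcomp Require Import ring lra zify.

Set Implicit Arguments.
Unset Strict Implicit.
Unset Printing Implicit Defensive.
Import Order.TTheory GRing.Theory Num.Theory.
Import numFieldNormedType.Exports.
Local Open Scope classical_set_scope.
Local Open Scope ring_scope.

Section KolmogorovSinai.
Context d (X : measurableType d) (R : realType).
Variables (mu : probability X R) (f : X -> X).

Definition invariant_measure : Prop :=
  forall A : set X, measurable A -> mu (f @^-1` A) = mu A.

(* Empty cells are allowed; they do not change the entropies below. *)
Definition measurable_partition k (A : 'I_k -> set X) : Prop :=
  [/\ forall i, measurable (A i), trivIset setT A & \bigcup_i A i = setT].

(* The cell, indexed by w, of the join of A, f^{-1} A, ..., f^{-(n-1)} A. *)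
Definition join_cell k (A : 'I_k -> set X) n (w : {ffun 'I_n -> 'I_k}) : set X :=
  [set x | forall i : 'I_n, A (w i) (iter i f x)].

(* Since ln 0 = 0, null cells contribute 0. *)
Definition join_entropy k (A : 'I_k -> set X) n : R :=
  - \sum_(w : {ffun 'I_n -> 'I_k})
      fine (mu (join_cell A w)) * ln (fine (mu (join_cell A w))).

(* For mu invariant under a measurable f the limit exists, by subadditivity. *)
Definition partition_entropy k (A : 'I_k -> set X) : \bar R :=
  limn (fun n => (join_entropy A n / n%:R)%:E).

Definition KS_entropy : \bar R :=
  ereal_sup [set e | exists k (A : 'I_k -> set X),
    measurable_partition A /\ e = partition_entropy A].

End KolmogorovSinai.

Section Renyi.
Context {R : realType}.
Implicit Types (x alpha : R) (psi : nat -> R).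

(* The functions below are meant on [0, 1[ only; they are total on R, and
   renyi maps the whole of R into [0, 1[. *)
Definition renyi x : R := (1 - x)^-1 - (Num.floor (1 - x)^-1)%:~R.

Definition b1 x : nat := absz (Num.floor (1 - x)^-1 + 1).

Definition renyi_deriv x : R := (1 - x) ^- 2.

Definition phi x : R := - ln (renyi_deriv x).

Lemma renyi_range x : renyi x \in `[0, 1[.
Proof.
rewrite in_itv /= /renyi subr_ge0 floor_le /= ltrBlDl.
by have := floorD1_gt (1 - x)^-1; rewrite intrD.
Qed.

Lemma floor_ge1 x : x \in `[0, 1[ -> 1 <= Num.floor (1 - x)^-1.
Proof.
rewrite in_itv /= => /andP[x0 x1].
by rewrite floor_ge_int invf_ge1 ?subr_gt0// gerBl.
Qed.

Lemma b1E x : x \in `[0, 1[ -> (b1 x)%:Z = Num.floor (1 - x)^-1 + 1.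
Proof. by move=> /floor_ge1 h; rewrite /b1 gez0_abs// addr_ge0// (le_trans _ h). Qed.

Lemma b1_ge2 x : x \in `[0, 1[ -> (2 <= b1 x)%N.
Proof. by move=> hx; have := b1E hx; have := floor_ge1 hx; lia. Qed.

(* renyi_deriv is the right derivative of renyi on [0, 1[; inside the branches
   [1 - 1/n, 1 - 1/(n+1)[ it is the derivative. *)
Lemma renyi_right_derivative x : x \in `[0, 1[ ->
  h^-1 * (renyi (x + h) - renyi x) @[h --> 0^'+] --> renyi_deriv x.
Proof.
move=> hx; have h1 := floor_ge1 hx.
move: hx; rewrite in_itv /= => /andP[x0 x1].
set N := Num.floor (1 - x)^-1.
have y0 : 0 < 1 - x by rewrite subr_gt0.
have N1 : (0 : R) < (N + 1)%:~R by rewrite ltr0z; lia.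
pose e := 1 - x - (N + 1)%:~R^-1.
have e0 : 0 < e.
  by rewrite subr_gt0 invf_plt ?posrE// floorD1_gt.
have ey : e < 1 - x by rewrite /e gtrBl invr_gt0.
apply: (@cvg_trans _ ((fun h : R => ((1 - x - h) * (1 - x))^-1) @ 0^'+)).
  apply: near_eq_cvg; near=> h.
  have hp : 0 < h by near: h; exact: nbhs_right_gt.
  have he : h < e by near: h; exact: nbhs_right_lt.
  have y1 : 0 < 1 - x - h by lra.
  have xhE : 1 - (x + h) = 1 - x - h by ring.
  have fE : Num.floor (1 - x - h)^-1 = N.
    apply: floor_def; apply/andP; split.
      apply: (@le_trans _ _ (1 - x)^-1); first exact: floor_le.
      by rewrite lef_pV2 ?posrE// lerBlDr lerDl ltW.
    by rewrite invf_plt ?posrE//; move: he; rewrite /e; lra.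
  rewrite /renyi xhE fE -/N.
  by field; rewrite !gt_eqF.
rewrite /renyi_deriv.
apply: cvg_at_right_filter.
have -> : (1 - x) ^- 2 = ((1 - x - 0) * (1 - x))^-1 by rewrite subr0 expr2.
apply: cvgV; first by rewrite subr0 mulf_neq0// gt_eqF.
apply: cvgMr_tmp; apply: cvgB; [exact: cvg_cst|exact: cvg_id].
Unshelve. all: by end_near. Qed.

(* Borel probability measures on [0, 1[ are encoded as the Borel probability
   measures on R giving full mass to [0, 1[. *)
Definition renyi_invariant : set (probability (measurableTypeR R) R) :=
  [set mu : probability (measurableTypeR R) R |
    mu `[0, 1[%classic = 1%E /\ invariant_measure mu renyi].

Definition renyi_invariant_phi : set (probability (measurableTypeR R) R) :=
  [set mu : probability (measurableTypeR R) R |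
    renyi_invariant mu /\ mu.-integrable `[0, 1[%classic (EFin \o phi)].

Definition chi (mu : probability (measurableTypeR R) R) : \bar R :=
  (- \int[mu]_(x in `[0%R, 1%R[%classic) (phi x)%:E)%E.

Definition free_energy (mu : probability (measurableTypeR R) R) : \bar R :=
  (KS_entropy mu renyi - chi mu)%E.

Definition rate_admissible psi alpha (eps : R) :
    set (probability (measurableTypeR R) R) :=
  [set mu : probability (measurableTypeR R) R | [/\ renyi_invariant_phi mu,
      mu.-integrable `[0, 1[%classic (EFin \o (psi \o b1)) &
      ((alpha - eps)%:E < \int[mu]_(x in `[0%R, 1%R[%classic) (psi (b1 x))%:E
        < (alpha + eps)%:E)%E]].

Definition rate_sup psi alpha (eps : R) : \bar R :=
  ereal_sup [set free_energy mu | mu in rate_admissible psi alpha eps].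

(* The limit in rate_function exists, by monotonicity in eps. *)
Lemma is_cvg_rate_sup psi alpha :
  cvg (rate_sup psi alpha eps @[eps --> (0:R)^'+]).
Proof.
apply: (@nondecreasing_at_right_is_cvge _ _ 0).
near=> y => e1 e2 _ _ le12; apply: ereal_sup_le => _ [mu [muT mui /andP[l u]] <-].
exists mu => //; split => //; apply/andP; split.
  by apply: le_lt_trans l; rewrite lee_fin; lra.
by apply: lt_le_trans u _; rewrite lee_fin; lra.
Unshelve. all: by end_near. Qed.

Definition rate_function psi alpha : \bar R :=
  (- lim (rate_sup psi alpha eps @[eps --> (0:R)^'+]))%E.

End Renyi.

(* Main.v *)
Require Import Defs.
From HB Require Import structures.
From mathcomp Require Import all_boot all_order all_algebra.
From mathcomp Require Import all_classical all_reals all_analysis.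
From mathcomp Require Import measurable_realfun.
From mathcomp Require Import ring lra zify.
Set Implicit Arguments.
Unset Strict Implicit.
Unset Printing Implicit Defensive.
Import Order.TTheory GRing.Theory Num.Theory.
Import numFieldNormedType.Exports.
Local Open Scope classical_set_scope.
Local Open Scope ring_scope.

(** Everything reduces to upper bounds on entropy and to a family of explicit
    periodic orbits.

    Entropy bounds.  Call a kernel [q b y] stochastic when its values are
    positive and sum to at most 1 over the digits [b >= 2], for every [y] in
    (0, 1].  Reading a digit word from its last letter to its first, a kernel
    gives every word a weight, and the weights of the words of one length sum
    to at most 1.  [KS_entropy_le_integral] says that if [- ln] of the weight
    of the first [n] digits of [x] is at most the Birkhoff sum of [g] plus
    [2 ln (n + 1)], then the entropy is at most the integral of [g].  Two
    kernels are needed.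
    - [q b y = y / ((y + b - 1)(y + b - 2))] is the transfer operator of the
      map normalised by the density [1 / x] of its infinite invariant measure.
      The telescoping of the sum over [b] replaces the absence of a finite
      absolutely continuous invariant measure.  The branches are Moebius maps,
      so their distortion over [n] steps is at most [(n + 1)^2] in spite of the
      indifferent fixed point 0, and [entropy_le_chi] follows: [F <= 0].
    - [q b y = (b - 1)^(-1/2) - b^(-1/2)] is of order [b^(-3/2)] while
      the derivative of the map is of order [b^2]; hence the gain
      [entropy_le_3quarter_chi], [h <= 3 ln 2 + (3/4) chi], that is
      [F <= 3 ln 2 - chi / 4].

    Proof of [KS_entropy_le_integral].  For an arbitrary finite partition, take
    [f] to be a step function that names the right cell outside a set of small
    measure.  On a cylinder of rank [n] the iterates are increasing, so the
    itineraries of [f] on it are linearly ordered and their number is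
    [O(n)].  Give the name of [x] the score (weight of the digits of [x]) times
    a product of conditional probabilities of the name given the itinerary of
    [f].  Picking in each cell of the [n]-th join a point whose score is
    nearly maximal, the scores sum to [O(n)], and the Gibbs inequality against
    them bounds the entropy of the join.  The approximation costs an
    arbitrarily small multiple of [n], and [ln O(n)] is negligible.

    The theorem.  If [psi n / ln n] is unbounded, the orbit with period [K]
    and digits [n, 2, ..., 2] has mean [psi 2 + (psi n - psi 2) / K] and
    exponent at most [(2 / K)(ln n + ln (K + 1))].  Choosing [K] as the integer
    part of [(psi n - psi 2) / (alpha - psi 2)] the mean tends to [alpha],
    and the exponent to 0 because [ln n] is small with respect to [psi n].  With
    [F <= 0] the rate vanishes at [alpha].  If [psi n <= C ln n + D], the
    mean of [psi] is at most an affine function of [chi]; a large mean forces a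
    large [chi], and [F <= 3 ln 2 - chi / 4] is then at most [-1]. *)

(** * Two general estimates *)

(** A sub-probability vector suffices on the right, because
    [p ln (q / p) <= q - p].  The [q i] with [p i = 0] are left free. *)
Lemma gibbs_inequality (R : realType) (I : finType) (p q : I -> R) :
  (forall i, 0 <= p i) -> \sum_i p i = 1 ->
  (forall i, 0 < p i -> 0 < q i) -> \sum_(i | 0 < p i) q i <= 1 ->
  - \sum_i p i * ln (p i) <= \sum_i p i * - ln (q i).
Proof.
move=> p0 p1 q0 q1.
suff: \sum_i (p i * ln (q i) - p i * ln (p i)) <= 0.
  rewrite sumrB; under [X in _ -> _ <= X]eq_bigr do rewrite mulrN.
  by rewrite sumrN; lra.
apply: (@le_trans _ _ (\sum_i ((if 0 < p i then q i else 0) - p i))).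
  apply: ler_sum => i _; have [pi0|] := ltP 0 (p i); last first.
    move=> pi0; have -> : p i = 0 by apply/eqP; rewrite eq_le pi0 p0.
    by rewrite !mul0r subr0.
  have qi0 := q0 _ pi0.
  rewrite -mulrBr -ln_div ?posrE//.
  have -> : q i / p i = 1 + (q i / p i - 1) by ring.
  apply: (@le_trans _ _ (p i * (q i / p i - 1))).
    rewrite ler_pM2l//; apply: le_ln1Dx.
    by rewrite ltrBrDl subrr divr_gt0.
  by rewrite mulrBr mulr1 mulrCA divff ?gt_eqF// mulr1.
by rewrite sumrB p1 -big_mkcond/= subr_le0.
Qed.

Lemma cvg_ln_over_n (R : realType) :
  (ln n.+1%:R / n%:R : R) @[n --> \oo] --> (0 : R).
Proof.
apply: (@squeeze_cvgr _ _ _ _ (fun=> 0) (fun n => 4 * (Num.sqrt (n%:R : R))^-1)).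
- near=> n; have n0 : (0 < n)%N by near: n; exists 1%N.
  have nR : (1 : R) <= n%:R by rewrite ler1n.
  rewrite divr_ge0 ?ln_ge0 ?ler1n//=.
  set s := Num.sqrt n%:R.
  have s0 : 0 < s by rewrite sqrtr_gt0; lra.
  have ss : s * s = n%:R by rewrite -expr2 sqr_sqrtr//; lra.
  rewrite ler_pdivrMr; last lra.
  have -> : 4 * s^-1 * n%:R = 4 * s by rewrite -ss; field; rewrite gt_eqF.
  have h : n.+1%:R <= (2 * s) ^+ 2.
    by rewrite -natr1 expr2; rewrite mulrACA ss; lra.
  apply: (@le_trans _ _ (ln ((2 * s) ^+ 2))).
    rewrite ler_ln ?posrE ?ltr0n ?exprn_gt0//; lra.
  rewrite lnXn; last lra.
  by have := @ln_sublinear _ (2 * s) ltac:(lra); rewrite -mulr_natl; lra.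
- exact: cvg_cst.
- rewrite -[X in _ --> X](mulr0 4); apply: cvgM; first exact: cvg_cst.
  apply/gtr0_cvgV0.
    by near=> n; rewrite sqrtr_gt0 ltr0n; near: n; exists 1%N.
  apply/cvgryPge => A; near=> n.
  have An : A ^+ 2 <= n%:R by near: n; exact: nbhs_infty_ger.
  by rewrite (le_trans (ler_norm A))// -sqrtr_sqr ler_wsqrtr.
Unshelve. all: by end_near. Qed.

(** * Digit words, their weights, and itineraries on a cylinder *)

Section Cylinders.
Context {R : realType}.
Implicit Types (x y : R) (s : seq nat) (n : nat).

Local Notation unit_itv := (`[0, 1[%classic : set R).

Lemma renyi_unit x : unit_itv (renyi x).
Proof. by have := renyi_range x. Qed.

Lemma iter_renyi_unit n x : unit_itv x -> unit_itv (iter n renyi x).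
Proof. by case: n => //= n _; exact: renyi_unit. Qed.

Lemma renyiE x : unit_itv x -> renyi x = (1 - x)^-1 - (b1 x)%:R + 1.
Proof.
move=> xI; have /(congr1 (intmul (1 : R))) := b1E xI.
by rewrite -pmulrn rmorphD /= /renyi => ->; ring.
Qed.

Definition inverse_branch (b : nat) (y : R) : R := (y + b%:R - 2) / (y + b%:R - 1).

Definition digits n x : seq nat := [seq b1 z | z <- traject renyi x n].

(** The right endpoint of the closure of the cylinder of the word: the image
    of 1 under the composed inverse branches. *)
Definition endpoint s : R := foldr inverse_branch 1 s.

(** The chain runs backwards: a letter is drawn given the point determined by
    the letters that follow it, as the transfer operator does. *)
Fixpoint weight (q : nat -> R -> R) s : R :=
  if s is b :: s' then q b (endpoint s') * weight q s' else 1.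

Lemma digits_ge2 n x : unit_itv x -> all (leq 2) (digits n x).
Proof.
elim: n x => [//|n IH] x xI; apply/andP; split; first exact: b1_ge2.
by apply: IH; exact: renyi_unit.
Qed.

Lemma endpoint_itv s : all (leq 2) s -> 0 < endpoint s <= 1.
Proof.
elim: s => [|b s IH] /=; first by rewrite ltr01 lexx.
rewrite -(ler_nat R) => /andP[b2 /IH /andP[y0 y1]].
rewrite -/(endpoint s) /inverse_branch divr_gt0 ?ler_pdivrMr; lra.
Qed.

(** All words of length [n] over a finite part of the alphabet, so that every sum
    over words stays finite. *)
Definition words (M n : nat) : seq (seq nat) :=
  iter n (fun W => [seq b :: s | s <- W, b <- iota 2 M]) [:: [::]].

Lemma mem_words M n s :
  (s \in words M n) = (size s == n) && all (fun b => 2 <= b < M.+2)%N s.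
Proof.
elim: n s => [|n IH] [|b s] //=.
  by apply/allpairsP => -[[? ?] []].
rewrite eqSS; apply/allpairsP/idP => [[[t c] [/= tW cM [-> ->]]]|].
  by move: tW cM; rewrite IH mem_iota add2n => /andP[-> ->] ->.
move=> /and3P[sn bM sM]; exists (s, b); split => //=.
  by rewrite IH sn sM.
by rewrite mem_iota add2n.
Qed.

Definition stochastic (q : nat -> R -> R) :=
  (forall b y, (2 <= b)%N -> 0 < y <= 1 -> 0 < q b y) /\
  (forall M y, 0 < y <= 1 -> \sum_(b <- iota 2 M) q b y <= 1).

Lemma weight_gt0 (q : nat -> R -> R) s :
  stochastic q -> all (leq 2) s -> 0 < weight q s.
Proof.
move=> [q0 _]; elim: s => [//|b s IHs] /= /andP[b2 s2].
by rewrite mulr_gt0 ?IHs// q0 ?endpoint_itv.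
Qed.

Lemma sum_weight_le1 (q : nat -> R -> R) M n :
  stochastic q -> \sum_(s <- words M n) weight q s <= 1.
Proof.
move=> stoq; elim: n => [|n IH]; first by rewrite big_seq1.
rewrite /= big_allpairs_dep/=; apply: le_trans IH.
rewrite big_seq [leRHS]big_seq; apply: ler_sum => s.
rewrite mem_words => /andP[_ sM].
have s2 : all (leq 2) s by apply: sub_all sM => b /andP[].
rewrite -mulr_suml ler_piMl ?(ltW (weight_gt0 stoq s2))//.
by apply: stoq.2; exact: endpoint_itv.
Qed.

(** Every branch is increasing. *)
Lemma iter_renyi_le n x x' : unit_itv x -> unit_itv x' -> x <= x' ->
  digits n x = digits n x' ->
  forall i, (i < n)%N -> iter i renyi x <= iter i renyi x'.
Proof.
elim: n x x' => [//|n IH] x x' xI xI' xx' /= [b1E dE] [|i] ltin //.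
rewrite !iterSr; apply: IH dE _ _ => //; do ?exact: renyi_unit.
move: xI xI'; rewrite /= !in_itv/= => /andP[x0 x1] /andP[x'0 x'1].
rewrite !renyiE/= ?in_itv/= ?x0 ?x'0// b1E !lerD2r.
by rewrite lef_pV2 ?posrE ?subr_gt0// lerD2l lerN2.
Qed.

(** [f] is constant on each interval cut out by the thresholds [ts]; for an
    indicator, a finite union of intervals. *)
Definition determined (ts : seq R) U (f : R -> U) :=
  forall x y, {in ts, forall t, (t <= x) = (t <= y)} -> f x = f y.

(** A single integer that records where the first [n] iterates stand with
    respect to the thresholds. *)
Definition level (ts : seq R) n x : nat :=
  (\sum_(i < n) count (fun t => t <= iter i renyi x)%R ts)%N.

Lemma level_le ts n x : (level ts n x <= n * size ts)%N.
Proof.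
rewrite -[n in (n * _)%N]card_ord -sum_nat_const.
by apply: leq_sum => i _; exact: count_size.
Qed.

Lemma count_sub_eq (T : eqType) (a b : pred T) (s : seq T) :
  subpred a b -> count a s = count b s -> {in s, a =1 b}.
Proof.
move=> ab; elim: s => [//|z s IH] /= e.
have le1 : (a z <= b z)%N by have := ab z; case: (a z) => // ->.
have le2 := sub_count ab s.
move=> c; rewrite inE => /predU1P[->|]; last by apply: IH; lia.
by case: (a z) (b z) le1 e => -[]//=; lia.
Qed.

(** On a cylinder the iterates are monotone in the point, so each of the counts
    that [level] adds up can only grow with it; if the sums agree, so do all
    the terms.  Hence a cylinder meets at most [n * size ts + 1] itineraries. *)
Lemma level_determines_itinerary ts n x x' : unit_itv x -> unit_itv x' ->
  digits n x = digits n x' -> level ts n x = level ts n x' ->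
  forall U (f : R -> U), determined ts f ->
  forall i, (i < n)%N -> f (iter i renyi x) = f (iter i renyi x').
Proof.
wlog xx' : x x' / x <= x'.
  move=> W xI xI' dE lE U f fts i ltin.
  have [xx'|/ltW xx'] := leP x x'; first exact: W.
  by apply/esym/W.
move=> xI xI' dE lE U f fts i ltin.
have mono := iter_renyi_le xI xI' xx' dE.
have sub (j : 'I_n) : subpred (fun t => t <= iter j renyi x) (fun t => t <= iter j renyi x').
  by move=> t /= /le_trans; apply; exact: mono.
have /leqif_sum := fun (j : 'I_n) (_ : true) => leqif_eq (sub_count (sub j) ts).
move=> [_]; rewrite -/(level ts n x) -/(level ts n x') lE eqxx => /esym/forallP/(_ (Ordinal ltin))/eqP/=.
by move=> /(count_sub_eq (sub (Ordinal ltin))) /= h; apply: fts => t /h.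
Qed.

End Cylinders.

(** * Approximation of Borel partitions by step functions *)

Section Approximation.
Context {R : realType}.
Implicit Types (ts : seq R) (U B : set R).

Lemma determinedS ts ts' V (f : R -> V) :
  {subset ts <= ts'} -> determined ts f -> determined ts' f.
Proof. by move=> sub fts x y xy; apply: fts => t /sub; exact: xy. Qed.

Lemma measurable_determined ts U : determined ts U ->
  measurable (U : set (measurableTypeR R)).
Proof.
elim: ts U => [|t ts IH] U Uts.
  have [[x Ux]|/nonemptyPn ->] := pselect (U !=set0); last exact: measurable0.
  by have -> : U = setT by apply/seteqP; split=> y // _; rewrite (Uts y x).
pose V b := [set x | exists y, [/\ U y, (t <= y) = b &
  {in ts, forall t', (t' <= x) = (t' <= y)}]].
have mV b : measurable (V b : set (measurableTypeR R)).
  apply: IH => x x' xx'; apply/propext.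
  by split=> -[y [Uy ty h]]; exists y; split => // s sts; rewrite -h// xx'.
have -> : U = (V true `&` `[t, +oo[%classic) `|` (V false `&` ~` `[t, +oo[%classic).
  apply/seteqP; split=> x /=; rewrite in_itv/= andbT.
    by move=> Ux; case: (boolP (t <= x)) => tx; [left|right]; split => //; exists x;
      split => //; exact: negbTE.
  by case=> -[[y [Uy ty h]]] tx; rewrite (Uts x y)// => s; rewrite inE => /predU1P[->|/h//];
    rewrite ty ?tx//; exact/negbTE/negP.
by apply: measurableU; apply: measurableI => //; apply: measurableC; exact: measurable_itv.
Qed.

Variable mu : probability (measurableTypeR R) R.

Definition approximable B := forall e : R, 0 < e ->
  exists ts U, determined ts U /\ (mu (B `\` U `|` U `\` B) < e%:E)%E.

Lemma determinedU ts ts' U U' : determined ts U -> determined ts' U' ->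
  determined (ts ++ ts') (U `|` U').
Proof.
move=> Uts Uts' x y xy; rewrite /setU/=.
by rewrite (Uts x y) ?(Uts' x y)// => t h; apply: xy; rewrite mem_cat h ?orbT.
Qed.

Lemma measurable_symdiff (B U : set (measurableTypeR R)) :
  measurable B -> measurable U -> measurable (B `\` U `|` U `\` B).
Proof. by move=> mB mU; apply: measurableU; exact: measurableD. Qed.

Lemma measure_bigsetU_le (I : eqType) (r : seq I) (F : I -> set (measurableTypeR R)) :
  (forall i, measurable (F i)) ->
  (mu (\big[setU/set0]_(i <- r) F i) <= \sum_(i <- r) mu (F i))%E.
Proof.
move=> mF; elim: r => [|i r IH]; first by rewrite !big_nil measure0.
rewrite !big_cons; apply: le_trans (leeD2l _ IH).
by apply: measureU2 => //; exact: bigsetU_measurable.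
Qed.

(** The approximable Borel sets form a sigma-algebra containing the rays; for a
    countable union, a finite part of it has almost the full measure. *)
Lemma measurable_approximable (B : set (measurableTypeR R)) :
  measurable B -> approximable B.
Proof.
suff: measurable `<=` [set B : set (measurableTypeR R) | measurable B /\ approximable B].
  by move=> h /h [].
have measE : @measurable _ (measurableTypeR R) = <<s @measurable_realfun.RGenCInfty.G R >>.
  exact: measurable_realfun.RGenCInfty.measurableE.
rewrite [X in X `<=` _]measE.
apply: smallest_sub; last first.
  move=> _ [t ->]; split; first exact: measurable_itv.
  move=> e e0; exists [:: t], `[t, +oo[%classic; split.
    move=> x y xy; apply/propext; rewrite /= !in_itv/= !andbT.
    by rewrite (xy t)// inE.
  by rewrite setDv setU0 measure0 lte_fin.
split.
- split; first exact: measurable0.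
  move=> e e0; exists [::], set0; split; first by [].
  by rewrite setD0 setU0 measure0 lte_fin.
- move=> C [mC aC]; rewrite setTD; split; first exact: measurableC.
  move=> e /aC [ts [U [Uts UC]]]; exists ts, (~` U); split.
    by move=> x y xy; rewrite /setC/= (Uts x y).
  by rewrite !setDE !setCK setUC ![~` _ `&` _]setIC -!setDE.
move=> F aF; split; first by apply: bigcup_measurable => k _; exact: (aF k).1.
have finapprox n : approximable (\big[setU/set0]_(i < n) F i).
  elim: n => [|n IH] e e0.
    exists [::], set0; split; first by [].
    by rewrite big_ord0 setD0 setU0 measure0 lte_fin.
  have e2 : 0 < e / 2 by rewrite divr_gt0.
  have [ts [U [Uts UB]]] := IH _ e2.
  have [ts' [U' [Uts' UB']]] := (aF n).2 _ e2.
  exists (ts ++ ts'), (U `|` U'); split; first exact: determinedU.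
  have mU := measurable_determined Uts; have mU' := measurable_determined Uts'.
  have mFn := (aF n).1.
  have mF : measurable (\big[setU/set0]_(i < n) F i : set (measurableTypeR R)).
    by apply: bigsetU_measurable => i _; exact: (aF i).1.
  rewrite big_ord_recr/=.
  set C := \big[setU/set0]_(i < n) F i in UB mF *.
  apply: (@le_lt_trans _ _ (mu ((C `\` U `|` U `\` C) `|` (F n `\` U' `|` U' `\` F n)))).
    apply: le_measure; rewrite ?inE; try by do ?[apply: measurableU|apply: measurableD].
    move=> x /= [[[Cx|Fx] nU]|[[Ux|U'x] nC]].
    + by left; left; split => // Ux; apply: nU; left.
    + by right; left; split => // Ux; apply: nU; right.
    + by left; right; split => // Cx; apply: nC; left.
    + by right; right; split => // Fx; apply: nC; right.
  apply: (@le_lt_trans _ _ (mu (C `\` U `|` U `\` C) + mu (F n `\` U' `|` U' `\` F n))%E).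
    by apply: measureU2; exact: measurable_symdiff.
  by rewrite [e]splitr EFinD lteD.
move=> e e0; have e2 : 0 < e / 2 by rewrite divr_gt0.
pose G n := \big[setU/set0]_(i < n) F i.
have mG n : measurable (G n : set (measurableTypeR R)).
  by apply: bigsetU_measurable => i _; exact: (aF i).1.
have mF : measurable (\bigcup_k F k : set (measurableTypeR R)).
  by apply: bigcup_measurable => k _; exact: (aF k).1.
have GF n : G n `<=` \bigcup_k F k.
  by rewrite /G -bigcup_mkord => x [i ? Fi]; exists i.
have cvgG : mu (G n) @[n --> \oo] --> mu (\bigcup_k F k).
  have -> : \bigcup_k F k = \bigcup_k G k.
    apply/seteqP; split=> x [k _ Fk]; last exact: (GF k).
    by exists k.+1 => //; rewrite /G -bigcup_mkord; exists k => /=.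
  apply: nondecreasing_cvg_mu => //.
    by apply: bigcup_measurable => k _; exact: mG.
  move=> m n mn; apply/subsetPset; rewrite /G -!bigcup_mkord.
  by move=> x [i /= im Fi]; exists i => //=; apply: leq_trans mn.
have [n Hn] : exists n, (mu ((\bigcup_k F k) `\` G n) < (e / 2)%:E)%E.
  have fF : mu (\bigcup_k F k) \is a fin_num by exact: fin_num_measure.
  have : \forall n \near \oo, (mu (\bigcup_k F k) - (e / 2)%:E < mu (G n))%E.
    move: cvgG; rewrite -(fineK fF) => /fine_cvgP[fG /cvgrPdist_lt/(_ _ e2)] H.
    near=> n; have : `|fine (mu (\bigcup_k F k)) - fine (mu (G n))| < e / 2 by near: n.
    rewrite -[X in (_ < X)%E]fineK; last exact: fin_num_measure.
    by rewrite -EFinB lte_fin ltr_norml => /andP[_]; lra.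
  move=> [n _ /(_ n (leqnn n)) H]; exists n.
  rewrite measureD//=; last by rewrite -ge0_fin_numE// fin_num_measure.
  have fG : mu (G n) \is a fin_num by exact: fin_num_measure.
  have -> : \bigcup_k F k `&` G n = G n by rewrite setIC; apply/setIidPl.
  move: H; rewrite /= -/(G n) -(fineK fF) -(fineK fG).
  rewrite -[X in (X < _)%E -> _]EFinB -[X in _ -> (X < _)%E]EFinB.
  by rewrite !lte_fin; lra.
have [ts [U [Uts UG]]] := finapprox n _ e2.
exists ts, U; split => //.
have mU := measurable_determined Uts.
apply: (@le_lt_trans _ _ (mu (((\bigcup_k F k) `\` G n) `|` (G n `\` U `|` U `\` G n)))).
  apply: le_measure; rewrite ?inE; try by do ?[apply: measurableU|apply: measurableD].
  move=> x /= [[Fx nU]|[Ux nF]].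
    by have [Gx|nG] := pselect (G n x); [right; left|left].
  by right; right; split => // /GF.
apply: le_lt_trans.
  by apply: measureU2; [exact: measurableD|exact: measurable_symdiff].
by rewrite [e]splitr EFinD lteD.
Unshelve. all: by end_near. Qed.

(** [f x] is an index whose approximating set contains [x], if there is one; it is
    wrong only where one of the approximations is. *)
Lemma approximable_partition k (A : 'I_k -> set (measurableTypeR R)) (e : R) :
  measurable_partition A -> 0 < e ->
  exists ts (f : R -> 'I_k), [/\ determined ts f,
    measurable ([set x | ~ A (f x) x] : set (measurableTypeR R)) &
    (mu [set x | ~ A (f x) x] < e%:E)%E].
Proof.
move=> [mA tA cA] e0.
have [i0 _] : exists i : 'I_k, True.
  by have : (\bigcup_i A i) 0 by [rewrite cA]; move=> [i _ _]; exists i.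
have k0 : (0 < k)%N by case: k i0 {A mA tA cA} => // -[].
have ek : 0 < e / 2 / k%:R by rewrite !divr_gt0 ?ltr0n.
have /choice[tU HtU] : forall i, exists tU : seq R * set R,
    determined tU.1 tU.2 /\ (mu (A i `\` tU.2 `|` tU.2 `\` A i) < (e / 2 / k%:R)%:E)%E.
  by move=> i; have [ts [U ?]] := measurable_approximable (mA i) ek; exists (ts, U).
pose ts := flatten [seq (tU i).1 | i <- enum 'I_k].
have Uts i : determined ts (tU i).2.
  apply: determinedS (HtU i).1 => t ti; apply/flattenP; exists (tU i).1 => //.
  by apply/mapP; exists i; rewrite ?mem_enum.
have mU i := measurable_determined (Uts i).
pose f x := odflt i0 [pick i | `[< (tU i).2 x >]].
have fts : determined ts f.
  move=> x y xy; rewrite /f; congr odflt; apply: eq_pick => i /=.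
  by rewrite (Uts i _ _ xy).
pose D i := A i `\` (tU i).2 `|` (tU i).2 `\` A i.
have sub : [set x | ~ A (f x) x] `<=` \big[setU/set0]_(i <- enum 'I_k) D i.
  rewrite -bigcup_seq => x /= nA.
  have [i _ Aix] : (\bigcup_i A i) x by rewrite cA.
  move: nA; rewrite /f; case: pickP => [j /asboolP Uj /= nAj|/(_ i) /asboolP nU _].
    by exists j => /=; [rewrite mem_enum|right].
  by exists i => /=; [rewrite mem_enum|left].
have mD i : measurable (D i : set (measurableTypeR R)) by exact: measurable_symdiff.
have mbad : measurable ([set x | ~ A (f x) x] : set (measurableTypeR R)).
  have -> : [set x | ~ A (f x) x] = \big[setU/set0]_(i <- enum 'I_k) (f @^-1` [set i] `\` A i).
    rewrite -bigcup_seq; apply/seteqP; split=> x /=.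
      by move=> nA; exists (f x) => //=; rewrite mem_enum.
    by case=> i _ /= [->].
  apply: bigsetU_measurable => i _; apply: measurableD => //.
  apply: (@measurable_determined ts) => x y xy.
  by rewrite /preimage/= (fts _ _ xy).
exists ts, f; split => //.
apply: (@le_lt_trans _ _ (\sum_(i <- enum 'I_k) mu (D i))%E).
  apply: le_trans (measure_bigsetU_le _ mD).
  by apply: le_measure; rewrite ?inE//; exact: bigsetU_measurable.
apply: (@le_lt_trans _ _ (\sum_(i < k) (e / 2 / k%:R)%:E)%E).
  by rewrite big_enum; apply: lee_sum => i _; exact/ltW/(HtU i).2.
rewrite sumEFin lte_fin sumr_const card_ord -[ltLHS]mulr_natr divfK ?pnatr_eq0 -?lt0n//.
by rewrite ltr_pdivrMr//; lra.
Qed.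

End Approximation.

(** * Measurability *)

Section Measurability.
Context {R : realType}.
Notation mR := (measurableTypeR R).

Lemma measurable_invr : measurable_fun setT (fun x : mR => x^-1 : mR).
Proof.
(* On nonnegative numbers, 0 included, the power of exponent -1 is the inverse,
   and squaring makes the argument nonnegative. *)
have -> : (fun x : mR => x^-1 : mR) = (fun x => x * (x ^+ 2) `^ (-1)).
  apply/funext => x; rewrite powR_inv1 ?sqr_ge0//.
  have [->|x0] := eqVneq x 0; first by rewrite invr0 mul0r.
  by rewrite expr2 invfM mulVKf.
apply: measurable_funM => //.
apply: (measurableT_comp (@measurable_powR R (-1))).
exact: measurable_funX.
Qed.

Lemma measurable_floor : measurable_fun setT (fun x : mR => (Num.floor x)%:~R : mR).
Proof.
apply: (measurability _ (measurable_realfun.RGenCInfty.measurableE R)).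
move=> _ [_ [t ->] <-]; rewrite setTI; apply: is_interval_measurable.
move=> x y; rewrite /preimage/= !in_itv/= !andbT => tx ty z /andP[xz _].
by rewrite in_itv/= andbT (le_trans tx)// ler_int le_floor.
Qed.

Lemma measurable_inv_1sub : measurable_fun setT (fun x : mR => (1 - x)^-1 : mR).
Proof. by apply: (measurableT_comp measurable_invr); exact: measurable_funB. Qed.

Lemma measurable_renyi : measurable_fun setT (@renyi R : mR -> mR).
Proof.
apply: measurable_funB; first exact: measurable_inv_1sub.
exact: (measurableT_comp measurable_floor measurable_inv_1sub).
Qed.

Lemma measurable_iter_renyi i : measurable_fun setT (iter i (@renyi R) : mR -> mR).
Proof.
elim: i => [|i IH]; first exact: measurable_id.
exact: (measurableT_comp measurable_renyi IH).
Qed.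

Lemma measurable_phi : measurable_fun setT (@phi R : mR -> mR).
Proof.
apply: measurable_funN; apply: (measurableT_comp (@measurable_ln R)).
have -> : @renyi_deriv R = fun x => (1 - x)^-1 ^+ 2.
  by apply/funext => x; rewrite /renyi_deriv exprVn.
by apply: measurable_funX; exact: measurable_inv_1sub.
Qed.

(** The digit is a function of an integer, and any set of integers is Borel. *)
Lemma measurable_digit_fun (psi : nat -> R) :
  measurable_fun setT (psi \o @b1 R : mR -> mR).
Proof.
move=> _ Y mY; rewrite setTI.
pose Z : set mR := [set m%:~R | m in [set m : int | Y (psi (absz (m + 1)))]].
have -> : (psi \o @b1 R) @^-1` Y =
    setT `&` (fun x : mR => (Num.floor (1 - x)^-1)%:~R : mR) @^-1` Z.
  rewrite setTI; apply/seteqP; split => x /=.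
    by move=> Yx; exists (Num.floor (1 - x)^-1).
  by case=> m Ym /eqP; rewrite eqr_int => /eqP mE; rewrite /b1 -mE.
apply: (measurableT_comp measurable_floor measurable_inv_1sub) => //.
apply: countable_measurable => //.
exact/(card_le_trans (card_image_le _ _))/countableP.
Qed.

End Measurability.

(** * Entropy of the iterated joins *)

Section NameWeight.
Context {R : realType}.
Notation unit_itv := (`[0, 1[%classic : set R).
Variables (q : nat -> R -> R) (stoq : stochastic q).
Variables (k : nat) (idx apx : R -> 'I_k) (ts : seq R) (apx_det : determined ts apx).
Variables (e : R) (e01 : 0 < e < 1).

(** The conditional law of the true index [c] given the approximate index [d].
    The mass [e] spread over all indices keeps every logarithm finite. *)
Definition kappa (c d : 'I_k) : R := if c == d then 1 - e else e / k%:R.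

Lemma kappa_gt0 c d : 0 < kappa c d.
Proof.
have k0 : (0 < k)%N by apply: leq_ltn_trans (ltn_ord c).
have [e0 e1] := andP e01.
by rewrite /kappa; case: ifP => _; rewrite ?subr_gt0// divr_gt0 ?ltr0n.
Qed.

Lemma sum_kappa_le1 d : \sum_c kappa c d <= 1.
Proof.
have k0 : (0 < k)%N by apply: leq_ltn_trans (ltn_ord d).
have [e0 e1] := andP e01.
have e'0 : 0 <= e / k%:R by rewrite divr_ge0 ?ler0n ?(ltW e0).
rewrite (bigD1 d)//= /kappa eqxx.
have -> : \sum_(c | c != d) (if c == d then 1 - e else e / k%:R) =
    \sum_(c | c != d) e / k%:R.
  by apply: eq_bigr => c /negbTE ->.
have : \sum_(c | c != d) e / k%:R <= \sum_(c : 'I_k) e / k%:R.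
  by rewrite [leRHS](bigD1 d)//= lerDr.
rewrite [X in _ <= X -> _]sumr_const card_ord -[X in _ <= X -> _]mulr_natr.
rewrite divfK ?pnatr_eq0 -?lt0n//; lra.
Qed.

Definition name_weight n x : R :=
  weight q (digits n x) * \prod_(i < n) kappa (idx (iter i renyi x)) (apx (iter i renyi x)).

Lemma name_weight_gt0 n x : unit_itv x -> 0 < name_weight n x.
Proof.
move=> xI; rewrite mulr_gt0 ?weight_gt0 ?digits_ge2//.
by apply: prodr_gt0 => i _; exact: kappa_gt0.
Qed.

Lemma term_le_sum_seq (I : eqType) (r : seq I) (F : I -> R) i :
  i \in r -> (forall j, 0 <= F j) -> F i <= \sum_(j <- r) F j.
Proof.
by move=> ir F0; rewrite (big_rem i)//= lerDl sumr_ge0.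
Qed.

(** Group the names by the digits and the level of the chosen points.  Within a
    group the itinerary of [apx] is the same, so the products of [kappa] sum to
    at most 1; there are at most [n * size ts + 1] levels, and the weights
    of the words sum to at most 1. *)
Lemma sum_name_weight_le n (P : pred {ffun 'I_n -> 'I_k}) (pt : {ffun 'I_n -> 'I_k} -> R) :
  (forall w, P w -> unit_itv (pt w) /\ forall i : 'I_n, idx (iter i renyi (pt w)) = w i) ->
  \sum_(w | P w) name_weight n (pt w) <= (n * size ts).+1%:R.
Proof.
move=> ptP; set K := (n * size ts)%N.
pose M := (\max_(w : {ffun 'I_n -> 'I_k}) \max_(b <- digits n (pt w)) b)%N.
have wordsP w : P w -> digits n (pt w) \in words M n.
  move=> /ptP [wI _]; rewrite mem_words size_map size_traject eqxx/=.
  apply/allP => b bw; rewrite [(2 <= b)%N](allP (digits_ge2 n wI) b bw) /= ltnS.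
  apply: leqW; apply: leq_trans (leq_bigmax w).
  exact: (@leq_bigmax_seq _ _ predT id).
pose F w s l := if (digits n (pt w) == s) && (level ts n (pt w) == l)
  then name_weight n (pt w) else 0.
have F0 w s l : P w -> 0 <= F w s l.
  by move=> /ptP [wI _]; rewrite /F; case: ifP => // _; exact/ltW/name_weight_gt0.
apply: (@le_trans _ _ (\sum_(w | P w) \sum_(s <- words M n) \sum_(0 <= l < K.+1) F w s l)).
  apply: ler_sum => w Pw.
  apply: le_trans (term_le_sum_seq (wordsP w Pw) _); last first.
    by move=> s; apply: sumr_ge0 => l _; exact: F0.
  have lK : level ts n (pt w) \in index_iota 0 K.+1 by rewrite mem_index_iota ltnS level_le.
  apply: le_trans (term_le_sum_seq lK _); last by move=> l; exact: F0.
  by rewrite /F !eqxx.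
rewrite exchange_big/=.
apply: (@le_trans _ _ (\sum_(s <- words M n) K.+1%:R * weight q s)); last first.
  by rewrite -mulr_sumr ler_piMr ?ler0n// sum_weight_le1.
rewrite big_seq [leRHS]big_seq; apply: ler_sum => s.
rewrite mem_words => /andP[_ sM].
have s2 : all (leq 2) s by apply: sub_all sM => b /andP[].
have ws0 := weight_gt0 stoq s2.
have -> : K.+1%:R * weight q s = \sum_(0 <= l < K.+1) weight q s.
  by rewrite sumr_const_nat subn0 mulr_natl.
rewrite exchange_big/=; apply: ler_sum => l _.
have [w0|nogroup] := pickP [pred w | P w && ((digits n (pt w) == s) && (level ts n (pt w) == l))]; last first.
  rewrite big1 ?ltW// => w Pw; rewrite /F; case: ifP => // sl.
  by have := nogroup w; rewrite /= Pw sl.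
move=> /and3P[Pw0 /eqP ds0 /eqP lv0].
pose d (i : 'I_n) := apx (iter i renyi (pt w0)).
apply: (@le_trans _ _ (\sum_(w : {ffun 'I_n -> 'I_k}) weight q s * \prod_i kappa (w i) (d i))).
  rewrite big_mkcond/=; apply: ler_sum => w _.
  have prod0 : 0 <= weight q s * \prod_i kappa (w i) (d i).
    by rewrite mulr_ge0 ?prodr_ge0// => [|i _]; rewrite ltW// kappa_gt0.
  case: ifP => // Pw; rewrite /F; case: ifP => // /andP[/eqP ds /eqP lv].
  have [wI wE] := ptP w Pw; have [w0I _] := ptP w0 Pw0.
  rewrite /name_weight ds ler_pM2l//; apply: ler_prod => i _.
  rewrite ltW ?kappa_gt0//= wE.
  by rewrite (@level_determines_itinerary _ ts n _ (pt w0) wI w0I _ _ _ apx) ?ds ?lv.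
rewrite -mulr_sumr -(bigA_distr_bigA (fun i c => kappa c (d i))) ler_piMr ?(ltW ws0)//.
by apply: prodr_ile1 => i _; rewrite sum_kappa_le1 andbT sumr_ge0// => c _; rewrite ltW// kappa_gt0.
Qed.

(** The factor 2 stands for the maximum, which need not be attained; it
    costs [ln 2] in all, not per iterate. *)
Lemma name_weight_near_max n (C : set R) : C `<=` unit_itv -> C !=set0 ->
  exists2 x, C x & forall y, C y -> name_weight n y <= 2 * name_weight n x.
Proof.
move=> CI [x0 Cx0].
have wle x : unit_itv x -> name_weight n x <= (n * size ts).+1%:R.
  move=> xI; pose w0 : {ffun 'I_n -> 'I_k} := [ffun i : 'I_n => idx (iter i renyi x)].
  (* A single name gives the bound that makes the supremum finite. *)
  have := @sum_name_weight_le n (pred1 w0) (fun=> x); rewrite big_pred1_eq; apply.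
  by move=> w /eqP ->; split => // i; rewrite ffunE.
pose S := [set name_weight n x | x in C].
have hS : has_sup S.
  split; first by exists (name_weight n x0), x0.
  by exists (n * size ts).+1%:R => _ [x Cx <-]; exact/wle/CI.
have S0 : 0 < sup S.
  apply: lt_le_trans (name_weight_gt0 n (CI _ Cx0)) _.
  by apply: sup_upper_bound => //; exists x0.
have S2 : 0 < sup S / 2 by rewrite divr_gt0.
have [_ [x Cx <-] xS] := sup_adherent S2 hS.
exists x => // y Cy; apply: (@le_trans _ _ (sup S)); last lra.
by apply: sup_upper_bound => //; exists y.
Qed.

Variables (mu : probability (measurableTypeR R) R) (mu1 : mu unit_itv = 1%E).
Variables (A : 'I_k -> set (measurableTypeR R)) (A_part : measurable_partition A).
Hypothesis (A_idx : forall x, A (idx x) x).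

Lemma partition_idx c x : A c x <-> idx x = c.
Proof.
split=> [Ac|<-//]; have [_ tA _] := A_part.
by apply: (tA) => //; exists x; split.
Qed.

Lemma measurable_join_cell n (w : {ffun 'I_n -> 'I_k}) :
  measurable (join_cell renyi A w : set (measurableTypeR R)).
Proof.
have [mA _ _] := A_part.
have -> : join_cell renyi A w = \bigcap_(i : 'I_n) (iter i renyi @^-1` A (w i)).
  by apply/seteqP; split => x /= h i; [move=> _|]; apply: h.
apply: fin_bigcap_measurable => // i _.
by rewrite -[X in measurable X]setTI; apply: measurable_iter_renyi.
Qed.

Lemma integral_join_cells n (G : measurableTypeR R -> R) :
  measurable_fun setT G -> (forall x, 0 <= G x) ->
  (\int[mu]_x (G x)%:E =
    \sum_(w : {ffun 'I_n -> 'I_k}) \int[mu]_(x in join_cell renyi A w) (G x)%:E)%E.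
Proof.
move=> mG G0; rewrite -big_enum.
have cov : \big[setU/set0]_(w <- enum {ffun 'I_n -> 'I_k}) join_cell renyi A w = setT.
  apply/seteqP; split => // x _; rewrite -bigcup_seq/=.
  exists [ffun i : 'I_n => idx (iter i renyi x)] => /=; first by rewrite mem_enum.
  by move=> i; rewrite ffunE.
rewrite -(@ge0_integral_bigsetU _ _ _ mu _ (join_cell renyi A (n:=n)) (EFin \o G)).
- by rewrite cov.
- exact: measurable_join_cell.
- exact: enum_uniq.
- move=> w w' _ _ [x [wx w'x]]; apply/ffunP => i.
  by have /partition_idx <- := wx i; have /partition_idx <- := w'x i.
- by rewrite cov; apply/measurable_EFinP.
- by move=> x _; rewrite lee_fin.
Qed.

(** The Gibbs inequality against the scores of the chosen points, divided by the
    bound on their sum.  A score is at least half that of any other point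
    of the cell, which turns the sum over the cells into an integral. *)
Lemma join_entropy_le_integral n (G : measurableTypeR R -> R) :
  measurable_fun setT G -> (forall x, 0 <= G x) ->
  (forall x, unit_itv x -> ln (2 * (n * size ts).+1%:R) - ln (name_weight n x) <= G x) ->
  ((join_entropy mu renyi A n)%:E <= \int[mu]_x (G x)%:E)%E.
Proof.
move=> mG G0 GE; set N := (n * size ts).+1.
pose C (w : {ffun 'I_n -> 'I_k}) := join_cell renyi A w `&` unit_itv.
have N0 : (0 : R) < N%:R by rewrite ltr0n.
have mI : measurable (unit_itv : set (measurableTypeR R)) by exact: measurable_itv.
have mC w : measurable (C w : set (measurableTypeR R)).
  by apply: measurableI => //; exact: measurable_join_cell.
have muC w : mu (join_cell renyi A w) = mu (C w).
  have mJ := measurable_join_cell w.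
  apply/eqP; rewrite eq_le; apply/andP; split; last first.
    by apply: le_measure; rewrite ?inE// => x [].
  rewrite (measureDI mu mJ mI) /= setDE.
  have -> : mu (join_cell renyi A w `&` ~` unit_itv) = 0%E.
    have mIC : mu (~` unit_itv) = 0%E by rewrite probability_setC// mu1 subee.
    apply/eqP; rewrite -measure_le0 -[leRHS]mIC.
    by apply: le_measure; rewrite ?inE//; [apply: measurableI => //|]; exact: measurableC.
  by rewrite add0e.
pose p w := fine (mu (C w)).
have p0 w : 0 <= p w by exact: fine_ge0.
have pE w : mu (C w) = (p w)%:E by rewrite fineK// fin_num_measure.
have ptex w : exists x, C w !=set0 ->
    C w x /\ forall y, C w y -> name_weight n y <= 2 * name_weight n x.
  have [/name_weight_near_max h|C0] := pselect (C w !=set0); last by exists 0.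
  by have [|x Cx xmax] := h n; [move=> x []|exists x].
have /choice[pt ptP] := ptex.
pose r w := name_weight n (pt w) / N%:R.
have Cne w : 0 < p w -> C w !=set0.
  apply: contraPP => /nonemptyPn C0; rewrite /p C0 measure0 ltxx.
  by [].
have sump : \sum_w p w = 1.
  have mcell w : (\int[mu]_(x in join_cell renyi A w) cst 1%E x = (p w)%:E)%E.
    by rewrite integral_cst; [rewrite mul1e; exact: etrans (muC w) (pE w)|exact: measurable_join_cell].
  have : (\int[mu]_x cst 1%E x =
      \sum_(w : {ffun 'I_n -> 'I_k}) \int[mu]_(x in join_cell renyi A w) cst 1%E x)%E.
    exact: (@integral_join_cells n (cst 1) (@measurable_cst _ _ _ _ _ _) (fun=> ler01)).
  have -> : (\int[mu]_x cst 1%E x = 1)%E.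
    by rewrite integral_cst// mul1e; exact: probability_setT.
  rewrite (eq_bigr _ (fun w _ => mcell w)) sumEFin.
  by case.
have gibbs : join_entropy mu renyi A n <= \sum_w p w * - ln (r w).
  rewrite /join_entropy; under eq_bigr => w _ do rewrite muC -/(p w).
  apply: gibbs_inequality => // [w /Cne Cw|].
    by rewrite divr_gt0// name_weight_gt0//; have [[]] := ptP w Cw.
  rewrite -mulr_suml ler_pdivrMr// mul1r.
  apply: sum_name_weight_le => w /Cne /(ptP w) [[wx xI] _]; split=> // i.
  exact/partition_idx/wx.
rewrite -lee_fin in gibbs; apply: le_trans gibbs _.
rewrite (integral_join_cells n mG G0) -sumEFin; apply: lee_sum => w _.
have GJ : (\int[mu]_(x in C w) (G x)%:E <= \int[mu]_(x in join_cell renyi A w) (G x)%:E)%E.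
  apply: ge0_subset_integral => //.
  - exact: measurable_join_cell.
  - by apply/measurable_EFinP; apply: measurable_funTS.
  - by move=> x _; rewrite lee_fin.
  - by move=> x [].
apply: le_trans GJ.
have [r0|r0] := leP (- ln (r w)) 0.
  apply: (@le_trans _ _ 0%E); last by apply: integral_ge0 => x _; rewrite lee_fin.
  by rewrite lee_fin mulr_ge0_le0.
have [pw0|pw0] := leP (p w) 0.
  have -> : p w = 0 by apply/eqP; rewrite eq_le pw0 p0.
  by rewrite mul0r; apply: integral_ge0 => x _; rewrite lee_fin.
have [[wx xI] xmax] := ptP w (Cne w pw0).
apply: (@le_trans _ _ (\int[mu]_(x in C w) (- ln (r w))%:E)%E).
  by rewrite integral_cst// [X in (_ <= _ * X)%E]pE -EFinM mulrC.
apply: ge0_le_integral => //.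
- by move=> x _; rewrite lee_fin ltW.
- by apply/measurable_EFinP; apply: measurable_funTS.
move=> x Cx; rewrite lee_fin; have xI' := Cx.2.
apply: le_trans (GE x xI'); rewrite /r.
move: (name_weight_gt0 n xI) (name_weight_gt0 n xI') (xmax x Cx).
move: (name_weight n (pt w)) (name_weight n x) => a b a0 b0 ba.
rewrite ln_div ?posrE// lnM ?posrE//.
have : ln b <= ln (2 * a) by rewrite ler_ln ?posrE ?mulr_gt0.
by rewrite lnM ?posrE//; lra.
Qed.

End NameWeight.

(** * Bounding the entropy by an integral *)

Section EntropyBound.
Context {R : realType}.
Notation unit_itv := (`[0, 1[%classic : set R).
Notation mR := (measurableTypeR R).
Variables (mu : probability mR R) (mu_inv : invariant_measure mu (@renyi R)).

Lemma integral_comp_renyi (f : mR -> R) :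
  measurable_fun setT f -> (forall x, 0 <= f x) ->
  (\int[mu]_x (f (renyi x))%:E = \int[mu]_x (f x)%:E)%E.
Proof.
move=> mf f0.
pose T : {RV mu >-> mR} :=
  HB.pack (@renyi R : mR -> mR) (isMeasurableFun.Build _ _ _ _ _ (@measurable_renyi R)).
transitivity (\int[distribution mu T]_x (f x)%:E)%E.
  rewrite ge0_integral_distribution//; first exact/measurable_EFinP.
by apply: eq_measure_integral => B mB _; exact: mu_inv.
Qed.

Lemma integral_birkhoff_sum n (f : mR -> R) :
  measurable_fun setT f -> (forall x, 0 <= f x) ->
  (\int[mu]_x (\sum_(i < n) f (iter i renyi x))%:E = n%:R%:E * \int[mu]_x (f x)%:E)%E.
Proof.
move=> mf f0; pose S m (x : mR) := \sum_(i < m) f (iter i renyi x).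
have mS m : measurable_fun setT (S m).
  by apply: measurable_sum => i; exact: (measurableT_comp mf (measurable_iter_renyi i)).
have S0 m x : 0 <= S m x by exact: sumr_ge0.
change (\int[mu]_x (S n x)%:E = n%:R%:E * \int[mu]_x (f x)%:E)%E.
elim: n => [|n IH].
  by rewrite mul0e /S; under eq_integral do rewrite big_ord0; rewrite integral0.
have SE x : S n.+1 x = f x + S n (renyi x).
  by rewrite /S big_ord_recl/=; congr (_ + _); apply: eq_bigr => i _; rewrite -iterSr.
under eq_integral do rewrite SE EFinD.
rewrite ge0_integralD//=.
- rewrite (integral_comp_renyi (mS n) (S0 n)) IH -natr1 EFinD ge0_muleDl ?lee_fin//.
  by rewrite mul1e addeC.
- by move=> x _; rewrite lee_fin.
- exact/measurable_EFinP.
- by move=> x _; rewrite lee_fin.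
- by apply/measurable_EFinP; exact: (measurableT_comp (mS n) measurable_renyi).
Qed.

Hypothesis mu1 : mu unit_itv = 1%E.

(** The term [2 ln (n + 1)], which makes room for the distortion of the Moebius
    branches, is sublinear and so disappears in the limit. *)
Theorem KS_entropy_le_integral (q : nat -> R -> R) (g : mR -> R) :
  stochastic q -> measurable_fun setT g -> (forall x, unit_itv x -> 0 <= g x) ->
  (forall n x, unit_itv x ->
    - ln (weight q (digits n x)) <= \sum_(i < n) g (iter i renyi x) + 2 * ln n.+1%:R) ->
  (KS_entropy mu (@renyi R) <= \int[mu]_(x in unit_itv) (g x)%:E)%E.
Proof.
move=> stoq mg g0 gq; apply: ge_ereal_sup => _ [k [A [A_part ->]]].
have mI : measurable (unit_itv : set mR) by exact: measurable_itv.
have ig0 : (0 <= \int[mu]_(x in unit_itv) (g x)%:E)%E.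
  by apply: integral_ge0 => x xI; rewrite lee_fin g0.
(* Should the limit not exist, [limn] takes its default value 0, which the
   integral of a nonnegative function bounds as well. *)
have [ent_cvg|ent_dvg] := pselect (cvgn (fun n => (join_entropy mu renyi A n / n%:R)%:E)); last first.
  by rewrite /partition_entropy (dvgP ent_dvg).
have [mA tA cA] := A_part.
have /choice[idx A_idx] : forall x : R, exists c, A c x.
  move=> x; have : (\bigcup_i A i) x by rewrite cA.
  by move=> [i _ Aix]; exists i.
have k0 : (0 < k)%N by apply: leq_ltn_trans (ltn_ord (idx 0)).
apply/lee_addgt0Pr => eta eta0.
(* A correct guess costs [- ln (1 - e) = eta / 3], and a wrong one [c1]; wrong
   guesses are rare enough to cost at most [eta / 3] on average. *)
pose c0 := eta / 3; have c00 : 0 < c0 by rewrite divr_gt0.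
pose e := 1 - expR (- c0).
have e01 : 0 < e < 1.
  by rewrite subr_gt0 expR_lt1 oppr_lt0 c00/= gtrBl expR_gt0.
have [e0 e1] := andP e01.
have ek0 : 0 < e / k%:R by rewrite divr_gt0 ?ltr0n.
have ek1 : e / k%:R <= 1.
  by rewrite ler_pdivrMr ?ltr0n// mul1r (le_trans (ltW e1))// ler1n.
pose c1 := - ln (e / k%:R).
have c10 : 0 <= c1 by rewrite oppr_ge0 ln_le0.
have delta0 : 0 < c0 / (c1 + 1) by rewrite divr_gt0 ?ltr_wpDl.
have [ts [apx [apx_det mE muE]]] := approximable_partition mu A_part delta0.
set E := [set x | _] in mE muE.
pose h (x : mR) : R := g x * \1_unit_itv x + (c1 * \1_E x + c0).
have mindic (B : set mR) : measurable B -> measurable_fun setT (\1_B : mR -> R).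
  by move=> mB; exact: measurable_indic.
have mh : measurable_fun setT h.
  apply: measurable_funD; first by apply: measurable_funM => //; exact: mindic.
  apply: measurable_funD => //; apply: measurable_funM => //; exact: mindic.
have gI0 x : 0 <= g x * \1_unit_itv x.
  by rewrite indicE; case: (boolP (x \in _)) => [/set_mem xI|]; rewrite ?mulr1 ?mulr0// g0.
have E0 x : 0 <= c1 * \1_E x by rewrite mulr_ge0// indicE.
have h0 x : 0 <= h x by rewrite !addr_ge0// ltW.
have hint : (\int[mu]_x (h x)%:E <= \int[mu]_(x in unit_itv) (g x)%:E + (2 * c0)%:E)%E.
  rewrite /h; under eq_integral do rewrite EFinD.
  rewrite ge0_integralD//=.
  - apply: leeD.
      rewrite [leRHS]integral_mkcond; apply: ge0_le_integral => //.
      + by move=> x _; rewrite lee_fin.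
      + by apply/measurable_EFinP; apply: measurable_funM => //; exact: mindic.
      + by apply/(measurable_restrictT _ _).1 => //; apply/measurable_EFinP; exact: measurable_funTS.
      + move=> x _; rewrite patchE indicE; case: ifP => _; by rewrite ?mulr1 ?mulr0.
    under eq_integral do rewrite EFinD.
    rewrite ge0_integralD//=.
    * rewrite mulr_natl mulr2n EFinD; apply: leeD.
        under eq_integral do rewrite EFinM.
        rewrite ge0_integralZl//=.
        + rewrite integral_indic// setIT; apply: (@le_trans _ _ (c1%:E * (c0 / (c1 + 1))%:E)%E).
            by apply: lee_wpmul2l => //; exact: ltW.
          by rewrite -EFinM lee_fin mulrA ler_pdivrMr ?ltr_wpDl// mulrDr mulr1 mulrC lerDl ltW.
        + by apply/measurable_EFinP; exact: mindic.
      rewrite integral_cst// -[leRHS]mule1; apply: lee_wpmul2l; first by rewrite lee_fin ltW.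
      exact: probability_le1.
    * by move=> x _; rewrite lee_fin.
    * by apply/measurable_EFinP; apply: measurable_funM => //; exact: mindic.
    * by move=> x _; rewrite lee_fin ltW.
  - by move=> x _; rewrite lee_fin.
  - by apply/measurable_EFinP; apply: measurable_funM => //; exact: mindic.
  - by move=> x _; rewrite lee_fin addr_ge0// ltW.
  - by apply/measurable_EFinP; apply: measurable_funD => //; apply: measurable_funM => //; exact: mindic.
have [ifin|ioo] := ltP (\int[mu]_(x in unit_itv) (g x)%:E)%E +oo%E; last first.
  by move: ioo; rewrite leye_eq => /eqP ->; rewrite addye ?leey.
have ig_fin : (\int[mu]_(x in unit_itv) (g x)%:E)%E \is a fin_num.
  by rewrite ge0_fin_numE.
have hpos : (0 <= \int[mu]_x (h x)%:E)%E by apply: integral_ge0 => x _; rewrite lee_fin.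
have hfin : (\int[mu]_x (h x)%:E)%E \is a fin_num.
  rewrite ge0_fin_numE//; apply: le_lt_trans hint _.
  by rewrite lte_add_pinfty// ltry.
set H := fine (\int[mu]_x (h x)%:E)%E.
have HE : (\int[mu]_x (h x)%:E)%E = H%:E by rewrite fineK.
pose K := ln (2 * (size ts).+1%:R) : R.
have K0 : 0 <= K by rewrite ln_ge0// -natrM ler1n.
have bound n : join_entropy mu renyi A n <= n%:R * H + (3 * ln n.+1%:R + K).
  have ln0 : 0 <= ln n.+1%:R :> R by rewrite ln_ge0// ler1n.
  pose G (x : mR) := \sum_(i < n) h (iter i renyi x) + (3 * ln n.+1%:R + K).
  have mS : measurable_fun setT (fun x : mR => \sum_(i < n) h (iter i renyi x)).
    by apply: measurable_sum => i; exact: (measurableT_comp mh (measurable_iter_renyi i)).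
  have S0 x : 0 <= \sum_(i < n) h (iter i renyi x) by exact: sumr_ge0.
  have cst0 : 0 <= 3 * ln n.+1%:R + K by rewrite addr_ge0// mulr_ge0.
  have := @join_entropy_le_integral _ q stoq k idx apx ts apx_det e e01 mu mu1 A A_part A_idx n G.
  have -> : (\int[mu]_x (G x)%:E = (n%:R * H + (3 * ln n.+1%:R + K))%:E)%E.
    rewrite /G; under eq_integral do rewrite EFinD.
    rewrite ge0_integralD//=.
    - rewrite integral_birkhoff_sum// HE integral_cst// [RHS]EFinD [X in _ = (X + _)%E]EFinM; congr (_ + _)%E.
      by rewrite -[RHS]mule1; congr (_ * _)%E; exact: probability_setT.
    - by move=> x _; rewrite lee_fin.
    - exact/measurable_EFinP.
  rewrite lee_fin; apply.
  - exact: measurable_funD.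
  - by move=> x; rewrite addr_ge0.
  move=> x xI; rewrite /G /name_weight [ln (weight _ _ * _)]lnM ?posrE; last 2 first.
  - by apply: weight_gt0 => //; exact: digits_ge2.
  - by apply: prodr_gt0 => i _; apply: kappa_gt0.
  have lnK : ln (2 * (n * size ts).+1%:R) <= ln n.+1%:R + K.
    rewrite addrC -lnM ?posrE ?mulr_gt0 ?ltr0n// ler_ln ?posrE ?mulr_gt0 ?ltr0n//.
    by rewrite -!natrM ler_nat -mulnA leq_mul2l/= mulSn mulnS
      [(size ts * n)%N]mulnC !addSn ltnS addnA leq_addl.
  have lnprod : - ln (\prod_(i < n) kappa e (idx (iter i renyi x)) (apx (iter i renyi x)))
      <= \sum_(i < n) (c1 * \1_E (iter i renyi x) + c0).
    elim: (n) => [|m IH]; first by rewrite !big_ord0 ln1 oppr0.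
    rewrite !big_ord_recr/= lnM ?posrE; last 2 first.
    - by apply: prodr_gt0 => i _; apply: kappa_gt0.
    - exact: kappa_gt0.
    rewrite opprD lerD// /kappa.
    set y := iter m renyi x; case: eqP => [ia|ia].
      by rewrite /e subKr expRK opprK ler_wpDl.
    rewrite indicE mem_set ?mulr1 ?lerDl ?(ltW c00)//.
    by move=> Ay; apply: ia; exact: (partition_idx A_part A_idx (apx y) y).1.
  have hsum : \sum_(i < n) h (iter i renyi x) = \sum_(i < n) g (iter i renyi x) +
      \sum_(i < n) (c1 * \1_E (iter i renyi x) + c0).
    rewrite -big_split/=; apply: eq_bigr => i _; rewrite /h.
    by rewrite indicE mem_set ?mulr1//; exact: iter_renyi_unit.
  have := gq n x xI; rewrite hsum; lra.
have -> : partition_entropy mu renyi A =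
  limn (fun n => (join_entropy mu renyi A n / n%:R)%:E) by [].
pose v n := (H + (3 * (ln n.+1%:R / n%:R) + K * n%:R^-1))%:E.
have v_cvg : v n @[n --> \oo] --> H%:E.
  apply: cvg_EFin; first by near=> n.
  rewrite /v /comp/= -[X in _ --> X]addr0; apply: cvgD; first exact: cvg_cst.
  rewrite -[X in _ --> X](addr0 0); apply: cvgD.
    by rewrite -[X in _ --> X](mulr0 3); apply: cvgM; [exact: cvg_cst|exact: cvg_ln_over_n].
  rewrite -[X in _ --> X](mulr0 K); apply: cvgM; first exact: cvg_cst.
  apply/gtr0_cvgV0; last exact: cvgr_idn.
  by near=> n; rewrite ltr0n; near: n; exists 1%N.
apply: (@le_trans _ _ H%:E).
  rewrite -(cvg_lim _ v_cvg)//; apply: lee_lim => //.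
    by apply/cvg_ex; exists H%:E.
  near=> n; have n0 : (0 < n%:R :> R) by rewrite ltr0n; near: n; exists 1%N.
  rewrite lee_fin ler_pdivrMr//; apply: le_trans (bound n) _.
  rewrite le_eqVlt; apply/orP; left; apply/eqP; field; rewrite (gt_eqF n0)//.
rewrite -HE; apply: le_trans hint _; apply: leeD2l.
by rewrite lee_fin /c0; lra.
Unshelve. all: by end_near. Qed.

End EntropyBound.

(** * Entropy and Lyapunov exponent *)

Section LyapunovBounds.
Context {R : realType}.
Notation unit_itv := (`[0, 1[%classic : set R).
Notation mR := (measurableTypeR R).
Implicit Types (x y : R) (s : seq nat).

(** The inverse branch [T_b y = (y + b - 2) / (y + b - 1)] has derivative
    [(y + b - 1)^(-2)], and this is [T_b' (y) * h (T_b y) / h y] for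
    [h x = 1 / x], which the transfer operator fixes. *)
Definition renyi_kernel (b : nat) y : R := y / ((y + b%:R - 1) * (y + b%:R - 2)).

Lemma stochastic_renyi_kernel : stochastic renyi_kernel.
Proof.
split=> [b y|M y /andP[y0 y1]].
  rewrite -(ler_nat R) => b2 /andP[y0 y1].
  by rewrite divr_gt0// mulr_gt0//; lra.
have -> : \sum_(b <- iota 2 M) renyi_kernel b y = 1 - y / (y + M%:R).
  elim: M => [|M IH]; first by rewrite big_nil addr0 divff ?gt_eqF// subrr.
  have M0 : (0 : R) <= M%:R by rewrite ler0n.
  rewrite -[M.+1]addn1 iotaD big_cat/= IH big_seq1 /renyi_kernel !natrD.
  by field; rewrite !gt_eqF//; lra.
by rewrite gerBl divr_ge0 ?addr_ge0 ?ler0n// ltW.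
Qed.

(** The derivative at 1 of the composed inverse branch is [denominator s ^- 2]. *)
Fixpoint denominator s : R :=
  if s is b :: s' then (endpoint s' + b%:R - 1) * denominator s' else 1.

Lemma denominator_gt0 s : all (leq 2) s -> 0 < denominator s.
Proof.
elim: s => [//|b s IH] /= /andP[b2 s2]; rewrite mulr_gt0 ?IH//.
have /andP[y0 _] := @endpoint_itv R _ s2.
by move: b2; rewrite -(ler_nat R); lra.
Qed.

Lemma weight_renyi_kernel s : all (leq 2) s ->
  weight renyi_kernel s = (denominator s ^+ 2 * endpoint s)^-1.
Proof.
elim: s => [_|b s IH] /=; first by rewrite expr1n !mulr1 invr1.
move=> /andP[b2 s2]; have /andP[y0 _] := @endpoint_itv R _ s2.
have D0 := denominator_gt0 s2.
rewrite IH// -/(endpoint s) /renyi_kernel /inverse_branch.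
move: b2; rewrite -(ler_nat R) => b2.
by field; rewrite !gt_eqF//; lra.
Qed.

(** The square root of the derivative of the [n]-th iterate. *)
Definition orbit_expansion n x : R := \prod_(i < n) (1 - iter i renyi x)^-1.

Lemma orbit_expansionS n x :
  orbit_expansion n.+1 x = (1 - x)^-1 * orbit_expansion n (renyi x).
Proof.
rewrite /orbit_expansion big_ord_recl/=; congr (_ * _).
by apply: eq_bigr => i _; rewrite -iterSr.
Qed.

Lemma inv_1sub_ge1 x : unit_itv x -> 1 <= (1 - x)^-1.
Proof. by rewrite /= in_itv/= => /andP[x0 x1]; rewrite invf_ge1 ?subr_gt0// gerBl. Qed.

Lemma orbit_expansion_ge1 n x : unit_itv x -> 1 <= orbit_expansion n x.
Proof.
elim: n x => [|n IH] x xI; first by rewrite /orbit_expansion big_ord0.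
by rewrite orbit_expansionS mulr_ege1 ?inv_1sub_ge1// IH//; exact: renyi_unit.
Qed.

(** The composed inverse branch is [y |-> (p y + q) / (r y + s)] with
    nonnegative coefficients.  The lemma compares its denominator at [y = 1] with
    that at the image of [x] under the [n]-th iterate; the second inequality does
    the same for the numerator, since prepending a digit mixes the two.  Each step
    adds at most 1 to the factor, whence linear growth. *)
Lemma denominator_distortion n x : unit_itv x ->
  let s := digits n x in
  denominator s <= n.+1%:R * orbit_expansion n x /\
  endpoint s * denominator s <= n.+1%:R * (x * orbit_expansion n x) + 1.
Proof.
elim: n x => [|n IH] x xI /=.
  move: xI; rewrite /= in_itv/= => /andP[x0 x1].
  by rewrite /orbit_expansion big_ord0 !mul1r mulr1; split=> //; lra.
have TI := renyi_unit x; have [] := IH _ TI.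
have s2 := digits_ge2 n TI.
have /andP[y0 _] := @endpoint_itv R _ s2.
have E1 := orbit_expansion_ge1 n TI.
have zE := renyiE xI; have z1 := inv_1sub_ge1 xI.
have b2 : (2 : R) <= (b1 x)%:R by rewrite ler_nat b1_ge2.
have xz : x * (1 - x)^-1 = (1 - x)^-1 - 1.
  by move: xI; rewrite /= in_itv/= => /andP[x0 x1]; field; lra.
rewrite orbit_expansionS [x * (_ * _)]mulrA xz.
change (map _ (traject _ (renyi x) n)) with (digits n (renyi x)).
rewrite -/(endpoint (digits n (renyi x))) /inverse_branch.
move: s2 y0 E1 zE z1 b2 => s2.
move: (denominator _) (endpoint _) (orbit_expansion _ _) (1 - x)^-1 (b1 x)%:R => D y E z b.
move=> y0 E1 -> z1 b2 h1 h2; rewrite -!(natr1 n.+1).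
have n0 : (0 : R) < n.+1%:R by rewrite ltr0n.
set N : R := n.+1%:R in h1 h2 n0 *.
have zE1 : 1 <= z * E by rewrite mulr_ege1.
have bD1 : (b - 1) * D <= (b - 1) * (N * E) by rewrite ler_wpM2l//; lra.
have bD2 : (b - 2) * D <= (b - 2) * (N * E) by rewrite ler_wpM2l//; lra.
split; first by nra.
rewrite mulrA divfK; last by rewrite gt_eqF//; lra.
nra.
Qed.

Lemma oppr_phi x : unit_itv x -> - phi x = 2 * ln (1 - x)^-1.
Proof.
move=> xI; rewrite /phi opprK /renyi_deriv -exprVn lnXn ?mulr_natl//.
exact: lt_le_trans (inv_1sub_ge1 xI).
Qed.

Lemma oppr_phi_ge0 x : unit_itv x -> 0 <= - phi x.
Proof. by move=> xI; rewrite oppr_phi// mulr_ge0// ln_ge0// inv_1sub_ge1. Qed.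

Lemma weight_renyi_kernel_lyapunov n x : unit_itv x ->
  - ln (weight renyi_kernel (digits n x)) <=
    \sum_(i < n) - phi (iter i renyi x) + 2 * ln n.+1%:R.
Proof.
move=> xI; have s2 := digits_ge2 n xI.
have D0 := denominator_gt0 s2; have /andP[y0 y1] := @endpoint_itv R _ s2.
have [DE _] := denominator_distortion n xI.
have E1 := orbit_expansion_ge1 n xI.
have E0 : 0 < orbit_expansion n x by exact: lt_le_trans E1.
have -> : \sum_(i < n) - phi (iter i renyi x) = 2 * ln (orbit_expansion n x).
  elim: (n) (x) (xI) => [|m IH] z zI.
    by rewrite big_ord0 /orbit_expansion big_ord0 ln1 mulr0.
  have TI := renyi_unit z.
  have z1 := inv_1sub_ge1 zI; have F1 := orbit_expansion_ge1 m TI.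
  rewrite orbit_expansionS big_ord_recl/= oppr_phi// lnM ?posrE; try lra.
  rewrite mulrDr -IH//; congr (_ + _).
  by apply: eq_bigr => i _; rewrite -iterSr.
rewrite weight_renyi_kernel// lnV ?posrE ?mulr_gt0 ?exprn_gt0// opprK.
rewrite lnM ?posrE ?exprn_gt0// lnXn// -mulr_natl.
have : ln (endpoint (digits n x) : R) <= 0 by exact: ln_le0.
have : ln (denominator (digits n x)) <= ln (n.+1%:R * orbit_expansion n x).
  by rewrite ler_ln ?posrE ?mulr_gt0.
by rewrite lnM ?posrE//; lra.
Qed.

(** Telescoping, of order [b^(-3/2)]: the exponent lies between 1, for
    summability, and 2, for a gain over the derivative. *)
Definition power_kernel (b : nat) (y : R) : R :=
  (Num.sqrt (b%:R - 1))^-1 - (Num.sqrt b%:R)^-1.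

Lemma power_kernel_ge b y : (2 <= b)%N ->
  (2 * Num.sqrt b%:R ^+ 3)^-1 <= power_kernel b y.
Proof.
rewrite -(ler_nat R) => b2; rewrite /power_kernel.
set s := Num.sqrt (b%:R - 1); set t := Num.sqrt b%:R.
have s0 : 0 < s by rewrite sqrtr_gt0; lra.
have st : s <= t by apply: ler_wsqrtr; lra.
have t0 : 0 < t by exact: lt_le_trans st.
have ss : s ^+ 2 = b%:R - 1 by rewrite sqr_sqrtr//; lra.
have tt : t ^+ 2 = b%:R by rewrite sqr_sqrtr//; lra.
have -> : s^-1 - t^-1 = (s * t * (s + t))^-1.
  have e1 : (t - s) * (s + t) = 1.
    by rewrite [s + t]addrC -subr_sqr ss tt; ring.
  have -> : (s * t * (s + t))^-1 = ((t - s) * (s + t)) / (s * t * (s + t)) by rewrite e1 mul1r.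
  by field; rewrite !gt_eqF//; lra.
rewrite lef_pV2 ?posrE ?mulr_gt0 ?exprn_gt0//; try lra.
rewrite !exprS expr0 mulr1; nra.
Qed.

Lemma stochastic_power_kernel : stochastic power_kernel.
Proof.
split=> [b y b2 _|M y _].
  apply: lt_le_trans (power_kernel_ge y b2).
  by rewrite invr_gt0 mulr_gt0// exprn_gt0// sqrtr_gt0 ltr0n; lia.
have -> : \sum_(b <- iota 2 M) power_kernel b y = 1 - (Num.sqrt M.+1%:R)^-1.
  elim: M => [|M IH]; first by rewrite big_nil sqrtr1 invr1 subrr.
  rewrite -[M.+1]addn1 iotaD big_cat/= IH big_seq1 /power_kernel add2n.
  have -> : M.+2%:R - 1 = M.+1%:R :> R by rewrite -(natr1 M.+1) addrK.
  by rewrite addn1; ring.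
by rewrite gerBl invr_ge0 sqrtr_ge0.
Qed.

Lemma power_kernel_phi x y : unit_itv x ->
  - ln (power_kernel (b1 x) y) <= 3 * ln 2 - 3 / 4 * phi x.
Proof.
move=> xI; have b2 := b1_ge2 xI; have z1 := inv_1sub_ge1 xI.
have zE := renyiE xI; have := renyi_unit x; rewrite /= in_itv/= => /andP[T0 T1].
have b0 : (0 : R) < (b1 x)%:R by rewrite ltr0n; lia.
have bz : (b1 x)%:R <= 2 * (1 - x)^-1 by lra.
have : - ln (power_kernel (b1 x) y) <= - ln ((2 * Num.sqrt (b1 x)%:R ^+ 3)^-1).
  rewrite lerN2 ler_ln ?posrE; first exact: power_kernel_ge.
    by rewrite invr_gt0 mulr_gt0// exprn_gt0// sqrtr_gt0.
  apply: lt_le_trans (power_kernel_ge y b2).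
  by rewrite invr_gt0 mulr_gt0// exprn_gt0// sqrtr_gt0.
rewrite lnV ?posrE ?mulr_gt0 ?exprn_gt0 ?sqrtr_gt0// opprK lnM ?posrE ?exprn_gt0 ?sqrtr_gt0//.
rewrite lnXn ?sqrtr_gt0// -[ln _ *+ 3]mulr_natl.
have -> : - (3 / 4 * phi x) = 3 / 2 * ln (1 - x)^-1 by rewrite -mulrN oppr_phi//; field.
have : 2 * ln (Num.sqrt (b1 x)%:R) = ln ((b1 x)%:R : R).
  by rewrite mulr_natl -lnXn ?sqrtr_gt0// sqr_sqrtr ?ltW.
have : ln ((b1 x)%:R : R) <= ln (2 * (1 - x)^-1) by rewrite ler_ln ?posrE//; lra.
rewrite lnM ?posrE//; last lra.
have : 0 <= ln 2 :> R by rewrite ln_ge0// ler1n.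
lra.
Qed.

Lemma weight_power_kernel_lyapunov n x : unit_itv x ->
  - ln (weight power_kernel (digits n x)) <=
    \sum_(i < n) (3 * ln 2 - 3 / 4 * phi (iter i renyi x)) + 2 * ln n.+1%:R.
Proof.
move=> xI; apply: (@le_trans _ _ (\sum_(i < n) (3 * ln 2 - 3 / 4 * phi (iter i renyi x)))); last first.
  by rewrite lerDl mulr_ge0// ln_ge0// ler1n.
elim: n x xI => [|n IH] x xI; first by rewrite big_ord0 ln1 oppr0.
have TI := renyi_unit x; have /= := digits_ge2 n.+1 xI => /andP[b2 s2].
rewrite big_ord_recl/= lnM ?posrE; last 2 first.
- by apply: stochastic_power_kernel.1 => //; exact: endpoint_itv.
- by apply: weight_gt0 => //; exact: stochastic_power_kernel.
rewrite opprD lerD ?power_kernel_phi//; apply: le_trans (IH _ TI) _.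
by apply: ler_sum => i _; rewrite -iterSr.
Qed.

Variable mu : probability mR R.
Hypothesis mu_phi : renyi_invariant_phi mu.

Lemma integral_oppr_phi : (\int[mu]_(x in unit_itv) (- phi x)%:E = chi mu)%E.
Proof.
have [_ iphi] := mu_phi.
rewrite /chi -integralN//; last exact: integrable_add_def.
Qed.

Lemma chi_fin : chi mu \is a fin_num.
Proof.
have [_ iphi] := mu_phi; rewrite fin_numN.
apply: integrable_fin_num => //; exact: measurable_itv.
Qed.

(** Ruelle's inequality. *)
Theorem entropy_le_chi : (KS_entropy mu (@renyi R) <= chi mu)%E.
Proof.
have [[mu1 mu_inv] iphi] := mu_phi; rewrite -integral_oppr_phi.
apply: (KS_entropy_le_integral mu_inv mu1 stochastic_renyi_kernel).
- by apply: measurable_funN; exact: measurable_phi.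
- exact: oppr_phi_ge0.
- exact: weight_renyi_kernel_lyapunov.
Qed.

(** In other words, the pressure at inverse temperature 3/4 is at most
    [3 ln 2]. *)
Theorem entropy_le_3quarter_chi :
  (KS_entropy mu (@renyi R) <= (3 * ln 2)%:E + (3 / 4)%:E * chi mu)%E.
Proof.
have [[mu1 mu_inv] iphi] := mu_phi.
have mI : measurable (unit_itv : set mR) by exact: measurable_itv.
have -> : ((3 * ln 2)%:E + (3 / 4)%:E * chi mu =
    \int[mu]_(x in unit_itv) (3 * ln 2 - 3 / 4 * phi x)%:E)%E.
  rewrite -integral_oppr_phi.
  have splitE x : ((3 * ln 2 - 3 / 4 * phi x)%:E = (3 * ln 2)%:E + (3 / 4)%:E * (- phi x)%:E)%E.
    by rewrite -EFinM -EFinD -[in LHS]mulrN.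
  under [RHS]eq_integral do rewrite splitE.
  have ln20 : 0 <= 3 * ln 2 :> R by rewrite mulr_ge0// ln_ge0// ler1n.
  have mphi : measurable_fun unit_itv (fun x : mR => (- phi x)%:E).
    by apply/measurable_EFinP; apply: measurable_funTS;
      apply: measurable_funN; exact: measurable_phi.
  have icst : (\int[mu]_(x in unit_itv) (3 * ln 2)%:E = (3 * ln 2)%:E)%E.
    by rewrite integral_cst// -[RHS]mule1; congr (_ * _)%E; exact: mu1.
  rewrite ge0_integralD//.
  - rewrite icst ge0_integralZl//.
    by move=> x xI; rewrite lee_fin oppr_phi_ge0.
  - move=> x xI; rewrite -EFinM lee_fin mulr_ge0 ?oppr_phi_ge0//; lra.
  - exact: measurable_funeM.
apply: (KS_entropy_le_integral mu_inv mu1 stochastic_power_kernel).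
- apply: measurable_funB => //; apply: measurable_funM => //; exact: measurable_phi.
- move=> x xI; have p0 := oppr_phi_ge0 xI.
  by have ln20 : 0 <= ln 2 :> R by [rewrite ln_ge0// ler1n]; lra.
- exact: weight_power_kernel_lyapunov.
Qed.

End LyapunovBounds.

(** * Periodic orbits with digits [m + 2, 2, ..., 2] *)

Section UniformMeasure.
Context {R : realType}.
Notation mR := (measurableTypeR R).
Variables (k : nat) (x : nat -> mR).

Let inv_nng : {nonneg R} := (k.+1%:R^-1)%:nng.

Definition uniform_on : set mR -> \bar R := mscale inv_nng (msum (fun i => \d_(x i)) k.+1).

HB.instance Definition _ := Measure.on uniform_on.

Lemma uniform_onE (A : set mR) :
  uniform_on A = ((k.+1%:R^-1)%:E * \sum_(i < k.+1) \d_(x i) A)%E.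
Proof. by []. Qed.

Lemma uniform_on_full (A : set mR) :
  (forall i, (i <= k)%N -> A (x i)) -> uniform_on A = 1%E.
Proof.
move=> Ax; rewrite uniform_onE (eq_bigr (fun=> 1%E)).
  by rewrite sumEFin -EFinM sumr_const card_ord -[X in _ * X]mulr_natr mul1r mulVf// pnatr_eq0.
by move=> i _; rewrite diracE mem_set//; apply: Ax; rewrite -ltnS.
Qed.

HB.instance Definition _ := @Measure_isProbability.Build _ _ R uniform_on
  (uniform_on_full (fun _ _ => I)).

Variable D : set mR.
Hypotheses (mD : measurable D) (Dx : forall i, (i <= k)%N -> D (x i)).

Lemma ge0_integral_uniform_on (f : mR -> \bar R) :
  measurable_fun D f -> (forall y, D y -> 0 <= f y)%E ->
  (\int[uniform_on]_(y in D) f y = (k.+1%:R^-1)%:E * \sum_(i < k.+1) f (x i))%E.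
Proof.
move=> mf f0; rewrite /uniform_on ge0_integral_mscale// ge0_integral_measure_sum//.
congr (_ * _)%E; apply: eq_bigr => i _.
by rewrite integral_dirac// diracE mem_set ?mul1e//; apply: Dx; rewrite -ltnS.
Qed.

Lemma integral_uniform_on (f : mR -> R) : measurable_fun D f ->
  (\int[uniform_on]_(y in D) (f y)%:E = (k.+1%:R^-1 * \sum_(i < k.+1) f (x i))%:E)%E.
Proof.
move=> mf; have mf' : measurable_fun D (EFin \o f) by exact/measurable_EFinP.
rewrite integralE !ge0_integral_uniform_on//.
- rewrite (eq_bigr (fun i : 'I_k.+1 => (Num.max (f (x i)) 0)%:E)); last first.
    by move=> i _; rewrite funeposE EFin_max.
  rewrite [X in (_ - _ * X)%E](eq_bigr (fun i : 'I_k.+1 => (Num.max (- f (x i)) 0)%:E)); last first.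
    by move=> i _; rewrite funenegE EFin_max.
  rewrite !sumEFin -!EFinM -EFinB -mulrBr -sumrB; congr (_ * _)%:E.
  by apply: eq_bigr => i _; rewrite /Num.max; do 2 case: ifPn; lra.
- exact: measurable_funeneg.
- exact: measurable_funepos.
Qed.

Lemma integrable_uniform_on (f : mR -> R) : measurable_fun D f ->
  uniform_on.-integrable D (EFin \o f).
Proof.
move=> mf; have mf' : measurable_fun D (EFin \o f) by exact/measurable_EFinP.
apply/integrableP; split => //.
rewrite ge0_integral_uniform_on//; first by rewrite sumEFin -EFinM ltry.
exact: measurableT_comp.
Qed.

End UniformMeasure.

Section PeriodicOrbit.
Context {R : realType}.
Notation unit_itv := (`[0, 1[%classic : set R).
Notation mR := (measurableTypeR R).

Lemma renyi_branch (x y : R) (d : nat) :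
  (1 - x)^-1 = d%:R + y -> 0 <= y < 1 -> renyi x = y /\ b1 x = d.+1.
Proof.
move=> xE y01; have fE : Num.floor (1 - x)^-1 = d%:Z.
  apply: floor_def; rewrite xE intrD -pmulrn.
  by rewrite lerDl ltrD2l.
split; first by rewrite /renyi fE xE -pmulrn; ring.
by rewrite /b1 fE -PoszD absz_nat addn1.
Qed.

(** In the coordinate [1 / x] the map is [u |-> u - 1] on the branch of the digit 2.
    After [K - 1] such steps from [u], the branch of the digit [M + 2] has to lead
    back to [u], which means [u = K + 1 / (M + 1 / u)]; this is the
    positive solution. *)
Definition period_top (K M : R) : R :=
  (K * M + Num.sqrt (K ^+ 2 * M ^+ 2 + 4 * M * K)) / (2 * M).

Lemma period_top_quadratic (K M : R) : 1 <= K -> 1 <= M ->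
  let u := period_top K M in M * u ^+ 2 = K * M * u + K.
Proof.
move=> K1 M1; have := @sqr_sqrtr _ (K ^+ 2 * M ^+ 2 + 4 * M * K).
rewrite /period_top; set r := Num.sqrt _ => h.
have {}h : r ^+ 2 = K ^+ 2 * M ^+ 2 + 4 * M * K.
  by apply: h; rewrite addr_ge0// ?mulr_ge0 ?sqr_ge0//; lra.
have M0 : M != 0 by rewrite gt_eqF//; lra.
have M4 : 4 * M != 0 by rewrite mulf_neq0.
apply: (mulfI M4).
have -> : 4 * M * (M * ((K * M + r) / (2 * M)) ^+ 2) = K ^+ 2 * M ^+ 2 + 2 * K * M * r + r ^+ 2.
  by field.
by rewrite h; field.
Qed.

Lemma period_top_gt (K M : R) : 1 <= K -> 1 <= M -> K < period_top K M.
Proof.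
move=> K1 M1.
have r0 : K * M < Num.sqrt (K ^+ 2 * M ^+ 2 + 4 * M * K).
  have e : K * M = Num.sqrt ((K * M) ^+ 2) by rewrite sqrtr_sqr ger0_norm//; nra.
  have p : 0 < 4 * M * K by nra.
  rewrite [ltLHS]e exprMn ltr_sqrt ?ltrDl//.
  by rewrite ltr_wpDl// mulr_ge0 ?sqr_ge0.
by rewrite /period_top ltr_pdivlMr; lra.
Qed.

Lemma period_top_lt (K M : R) : 1 <= K -> 1 <= M -> period_top K M < K + 1.
Proof.
move=> K1 M1; have q := period_top_quadratic K1 M1; have g := period_top_gt K1 M1.
move: (period_top K M) q g => u /= q g.
rewrite ltNge; apply/negP => h.
have : M * (K + 1) * u <= M * u ^+ 2.
  by rewrite expr2 mulrA ler_pM2r; nra.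
rewrite q; nra.
Qed.

Lemma period_topE (K M : R) : 1 <= K -> 1 <= M ->
  let u := period_top K M in u - K = u / (M * u + 1).
Proof.
move=> K1 M1; have q := period_top_quadratic K1 M1; have g := period_top_gt K1 M1.
move: (period_top K M) q g => /= u q g.
have d0 : M * u + 1 != 0 by rewrite gt_eqF//; nra.
apply: (mulIf d0); rewrite divfK//.
have -> : (u - K) * (M * u + 1) = M * u ^+ 2 - K * M * u + u - K by ring.
by rewrite q; ring.
Qed.

Variables (k m : nat) (m0 : (0 < m)%N).

Definition orbit_top : R := period_top k.+1%:R m%:R.
Notation u := orbit_top.

Lemma orbit_top_gt : k.+1%:R < u.
Proof. by apply: period_top_gt; rewrite ler1n. Qed.

Lemma orbit_top_lt : u < k.+1%:R + 1.
Proof. by apply: period_top_lt; rewrite ler1n. Qed.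

Lemma orbit_top_gt0 : 0 < u.
Proof. by apply: le_lt_trans orbit_top_gt; rewrite ler0n. Qed.

Lemma orbit_topE : u - k.+1%:R = u / (m%:R * u + 1).
Proof. by apply: period_topE; rewrite ler1n. Qed.

Definition orbit_point (i : nat) : mR := (u - i%:R)^-1.

Lemma orbit_height i : (i <= k)%N -> 1 < u - i%:R.
Proof.
move=> ik; have g := orbit_top_gt.
have : i.+1%:R <= k.+1%:R :> R by rewrite ler_nat ltnS.
by rewrite -natr1; lra.
Qed.

Lemma orbit_point_unit i : (i <= k)%N -> unit_itv (orbit_point i).
Proof.
move=> /orbit_height h; rewrite /orbit_point/= in_itv/= invr_ge0 invf_lt1; lra.
Qed.

Lemma inv_1sub_orbit i : (i <= k)%N ->
  (1 - orbit_point i)^-1 = 1 + (u - i.+1%:R)^-1.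
Proof.
move=> /orbit_height h; rewrite /orbit_point -natr1.
by field; apply/andP; split; rewrite gt_eqF//; lra.
Qed.

Lemma renyi_orbit_point i : (i < k)%N ->
  renyi (orbit_point i) = orbit_point i.+1 /\ b1 (orbit_point i) = 2%N.
Proof.
move=> ik; apply: renyi_branch; first by rewrite inv_1sub_orbit// ltnW.
by have := orbit_point_unit ik; rewrite /= in_itv.
Qed.

Lemma renyi_orbit_last :
  renyi (orbit_point k) = orbit_point 0 /\ b1 (orbit_point k) = m.+2.
Proof.
have u0 := orbit_top_gt0; have Mu0 : 0 < m%:R * u by rewrite mulr_gt0 ?ltr0n.
apply: renyi_branch; last by have := orbit_point_unit (leq0n k); rewrite /= in_itv.
rewrite inv_1sub_orbit// orbit_topE /orbit_point subr0 -natr1.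
by field; apply/andP; split; rewrite gt_eqF//; lra.
Qed.

Definition periodic_measure : probability mR R := uniform_on k orbit_point.

Lemma periodic_measure_invariant : renyi_invariant periodic_measure.
Proof.
split; first by apply: uniform_on_full => i; exact: orbit_point_unit.
move=> A mA; rewrite /periodic_measure/= !uniform_onE; congr (_ * _)%E.
rewrite big_ord_recr [in RHS]big_ord_recl/= addeC; congr (_ + _)%E.
  by rewrite !diracE; congr (_%:R%:E); rewrite -[in RHS]renyi_orbit_last.1.
apply: eq_bigr => i _; rewrite !diracE; congr (_%:R%:E).
by rewrite -[in RHS](renyi_orbit_point (ltn_ord i)).1.
Qed.

Let mI : measurable (unit_itv : set mR). Proof. exact: measurable_itv. Qed.

Lemma periodic_measure_phi : renyi_invariant_phi periodic_measure.
Proof.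
split; first exact: periodic_measure_invariant.
apply: integrable_uniform_on => //; first exact: orbit_point_unit.
by apply: measurable_funTS; exact: measurable_phi.
Qed.

Lemma periodic_measure_digit (psi : nat -> R) :
  periodic_measure.-integrable unit_itv (EFin \o (psi \o @b1 R)) /\
  (\int[periodic_measure]_(x in unit_itv) (psi (b1 x))%:E =
   (psi 2%N + (psi m.+2 - psi 2%N) / k.+1%:R)%:E)%E.
Proof.
have mpsi : measurable_fun unit_itv (psi \o @b1 R : mR -> mR).
  by apply: measurable_funTS; exact: measurable_digit_fun.
split; first by apply: integrable_uniform_on => //; exact: orbit_point_unit.
rewrite (integral_uniform_on mI orbit_point_unit mpsi); congr (_%:E).
rewrite big_ord_recr/= renyi_orbit_last.2.
rewrite (eq_bigr (fun=> psi 2%N)); last by move=> i _; rewrite (renyi_orbit_point (ltn_ord i)).2.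
rewrite sumr_const card_ord -[psi 2%N *+ k]mulr_natr.
have K0 : k.+1%:R != 0 :> R by rewrite pnatr_eq0.
have -> : k%:R = k.+1%:R - 1 :> R by rewrite -natr1 addrK.
by field.
Qed.

(** The derivative at [1 / u] is [(u / (u - 1))^2], so the product along the
    orbit telescopes to [(u / (u - K))^2 = (M u + 1)^2] with [K = k + 1]. *)
Lemma chi_periodic_measure :
  chi periodic_measure = (2 / k.+1%:R * ln (m%:R * u + 1))%:E.
Proof.
rewrite /chi (integral_uniform_on mI orbit_point_unit); last first.
  by apply: measurable_funTS; exact: measurable_phi.
rewrite -EFinN; congr (_%:E); rewrite -mulrN -sumrN.
have -> : \sum_(i < k.+1) - phi (orbit_point i) = 2 * ln (m%:R * u + 1).
  have g := orbit_top_gt.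
  have tele j : (j <= k.+1)%N -> \sum_(i < j) - phi (orbit_point i) =
      2 * (ln u - ln (u - j%:R)).
    elim: j => [|j IH] jk; first by rewrite big_ord0 subr0 subrr mulr0.
    have h := orbit_height jk.
    have h1 : 0 < u - j.+1%:R.
      by have : j.+1%:R <= k.+1%:R :> R by [rewrite ler_nat]; lra.
    rewrite big_ord_recr/= IH ?(ltnW jk)//.
    rewrite /phi opprK /renyi_deriv -exprVn inv_1sub_orbit//.
    have -> : 1 + (u - j.+1%:R)^-1 = (u - j%:R) / (u - j.+1%:R).
      by move: h1; rewrite -natr1 => h1; field; rewrite gt_eqF//; lra.
    rewrite lnXn ?divr_gt0//; try lra.
    by rewrite ln_div ?posrE//; try lra; rewrite -mulr_natl; ring.
  have u0 := orbit_top_gt0.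
  have Mu : 0 < m%:R * u + 1 by rewrite addr_gt0// mulr_gt0 ?ltr0n.
  by rewrite tele// orbit_topE ln_div ?posrE//; ring.
by ring.
Qed.

Lemma chi_periodic_measure_le :
  (chi periodic_measure <= (2 / k.+1%:R * (ln m.+2%:R + ln k.+2%:R))%:E)%E.
Proof.
rewrite chi_periodic_measure lee_fin ler_wpM2l ?divr_ge0//.
have u0 := orbit_top_gt0; have l := orbit_top_lt.
have m1 : 1 <= m%:R :> R by rewrite ler1n.
have Mu0 : 0 < m%:R * u by rewrite mulr_gt0 ?ltr0n.
rewrite -lnM ?posrE ?ltr0n// ler_ln ?posrE ?mulr_gt0 ?ltr0n//; last lra.
have -> : m.+2%:R = m%:R + 2 :> R by rewrite -addn2 natrD.
have -> : k.+2%:R = k.+1%:R + 1 :> R by rewrite -natr1.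
have : m%:R * u <= m%:R * (k.+1%:R + 1) by rewrite ler_wpM2l ?ler0n// ltW.
have : 0 <= k.+1%:R :> R by rewrite ler0n.
lra.
Qed.

End PeriodicOrbit.

(** * The rate function *)

Lemma limn_esup_pinftyP (R : realType) (u : nat -> R) :
  limn_esup (fun n => (u n)%:E) = +oo%E <->
  forall (A : R) N, exists2 n, (N <= n)%N & A < u n.
Proof.
split=> [uoo A N|H].
  have : (A%:E < ereal_sup [set (u n)%:E | n in [set n | (N <= n)%N]])%E.
    apply: (@lt_le_trans _ _ +oo%E); first by rewrite ltry.
    rewrite -uoo; apply: ereal_inf_lbound; exists [set n | (N <= n)%N] => //.
    by exists N.
  by move=> /ereal_sup_gt[_ [n /= Nn <-]]; rewrite lte_fin; exists n.
apply/eqP; rewrite -leye_eq; apply: le_ereal_inf_tmp => _ [V [N _ NV] <-].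
rewrite leye_eq; apply/eqP/eq_infty => A.
have [n Nn An] := H A N; apply: (@le_trans _ _ (u n)%:E); first by rewrite lee_fin ltW.
by apply: ereal_sup_ubound; exists n => //; exact: NV.
Qed.

Section RateFunction.
Context {R : realType}.
Notation unit_itv := (`[0, 1[%classic : set R).
Notation mR := (measurableTypeR R).
Implicit Types (mu : probability mR R) (psi : nat -> R).

Lemma KS_entropy_ge0 mu : (0 <= KS_entropy mu (@renyi R))%E.
Proof.
apply: ereal_sup_ubound; exists 1%N, (fun=> setT); split.
  split; first by move=> _; exact: measurableT.
    by move=> i j _ _ _; rewrite !ord1.
  by apply/seteqP; split => // x _; exists ord0.
rewrite /partition_entropy; apply/esym/cvg_lim => //.
have -> : (fun n => (join_entropy mu renyi (fun _ : 'I_1 => [set: mR]) n / n%:R)%:E) = cst 0%E.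
  apply/funext => n; rewrite /join_entropy big1 ?oppr0 ?mul0r// => w _.
  rewrite (_ : join_cell _ _ _ = setT); last by apply/seteqP; split.
  by rewrite probability_setT ln1 mulr0.
exact: cvg_cst.
Qed.

Lemma free_energy_le0 mu : renyi_invariant_phi mu -> (free_energy mu <= 0)%E.
Proof. by move=> muP; rewrite sube_le0 entropy_le_chi. Qed.

Lemma free_energy_ge mu : renyi_invariant_phi mu -> (- chi mu <= free_energy mu)%E.
Proof. by move=> muP; rewrite -[leLHS]add0e leeD2r// KS_entropy_ge0. Qed.

Lemma free_energy_le_quarter_chi mu : renyi_invariant_phi mu ->
  (free_energy mu <= (3 * ln 2 - fine (chi mu) / 4)%:E)%E.
Proof.
move=> muP; have := entropy_le_3quarter_chi muP; rewrite /free_energy.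
rewrite -(fineK (chi_fin muP)) -EFinM -EFinD => h.
apply: (@le_trans _ _ ((3 * ln 2 + 3 / 4 * fine (chi mu))%:E - (fine (chi mu))%:E)%E).
  exact: leeD.
by rewrite -EFinB lee_fin; lra.
Qed.

(** A digit [n] with [psi n >= A ln n] and [A] large, and a period [K] that is the
    integer part of [(psi n - psi 2) / (alpha - psi 2)]. *)
Lemma periodic_approximation psi alpha eps eta :
  limn_esup (fun n => (psi n / ln (n%:R : R))%:E) = +oo%E ->
  psi 2%N < alpha -> 0 < eps -> 0 < eta ->
  exists2 mu, rate_admissible psi alpha eps mu & (chi mu <= eta%:E)%E.
Proof.
move=> /limn_esup_pinftyP psioo alpha2 eps0 eta0.
pose beta := alpha - psi 2%N; have beta0 : 0 < beta by rewrite subr_gt0.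
have [K0 HK0] : exists K0 : nat, forall K, (K0 <= K)%N -> ln K.+1%:R / K%:R < eta / 4 :> R.
  have /cvgrPdist_lt/(_ (eta / 4)) := @cvg_ln_over_n R.
  move=> /(_ ltac:(by rewrite divr_gt0)) [K0 _ H]; exists K0 => K /H /=.
  by rewrite sub0r normrN; apply: le_lt_trans; exact: ler_norm.
pose t := K0%:R + 1 + beta / eps.
have be0 : 0 < beta / eps by rewrite divr_gt0.
have K00 : 0 <= K0%:R :> R by rewrite ler0n.
set p2 := psi 2%N in alpha2 beta beta0 be0 t *.
(* [t] is a lower bound to impose on [K]; the terms of [A] make [psi n]
   exceed [psi 2 + beta (t + 1)], and [ln n / K] small. *)
pose A := 1 + `|p2| + beta * (t + 1) + 4 * (2 * beta + `|p2|) / eta.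
have [p2le np2] : p2 <= `|p2| /\ 0 <= `|p2| by rewrite ler_norm normr_ge0.
have bt0 : 0 < beta * (t + 1) by rewrite mulr_gt0// /t; lra.
have Ar0 : 0 <= 4 * (2 * beta + `|p2|) / eta.
  by rewrite divr_ge0 ?(ltW eta0)// mulr_ge0// addr_ge0// mulr_ge0// ltW.
have [n Nn An] := psioo A (maxn 3 (Num.truncn (expR 1 : R)).+1).
have n3 : (3 <= n)%N by apply: leq_trans Nn; rewrite leq_maxl.
have ln1 : 1 <= ln (n%:R : R).
  have en : expR 1 <= n%:R :> R.
    have : (Num.truncn (expR 1 : R) < n)%N by apply: leq_trans Nn; rewrite leq_maxr.
    by rewrite truncn_lt_nat ?expR_ge0// => /ltW.
  have e0 : 0 < expR 1 :> R by exact: expR_gt0.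
  have : ln (expR 1 : R) <= ln n%:R by rewrite ler_ln ?posrE//; exact: lt_le_trans en.
  by rewrite expRK.
have psiA : A * ln n%:R < psi n by rewrite -ltr_pdivlMr//; lra.
have A0 : 0 < A by rewrite /A; lra.
have A_le_psi : A < psi n by apply: le_lt_trans psiA; rewrite ler_peMr// ltW.
pose d := (psi n - p2) / beta.
have d_t : t + 1 < d by rewrite ltr_pdivlMr// /A in A_le_psi *; lra.
have d0 : 0 <= d by rewrite /t in d_t; lra.
pose K := Num.truncn d.
have /andP[Kd dK] : K%:R <= d < K.+1%:R := truncn_itv d0.
rewrite -natr1 in dK.
have Kt : t < K%:R by lra.
have K1 : 1 <= K%:R :> R by rewrite /t in Kt; lra.
have K0' : 0 < K%:R :> R by lra.
have KK0 : (K0 <= K)%N by rewrite -(ler_nat R); rewrite /t in Kt; lra.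
have Keps : beta / eps < K%:R by rewrite /t in Kt; lra.
have psid : psi n = beta * d + p2 by rewrite /d mulrC divfK ?gt_eqF// subrK.
have KE : K = K.-1.+1 by rewrite prednK// -(ltr0n R).
have nE : n = (n - 2).+2 by rewrite -addn2 subnK// ltnW.
have m0 : (0 < n - 2)%N by rewrite subn_gt0.
exists (periodic_measure K.-1 (n - 2)); last first.
  apply: le_trans (chi_periodic_measure_le K.-1 m0) _; rewrite -nE -KE lee_fin.
  have lnK := HK0 _ KK0.
  rewrite mulrDr.
  have -> : 2 / K%:R * ln K.+1%:R = 2 * (ln K.+1%:R / K%:R) :> R by ring.
  suff : 2 / K%:R * ln n%:R <= eta / 2 by lra.
  rewrite mulrAC ler_pdivrMr//.
  have lnn : ln n%:R < psi n / A by rewrite ltr_pdivlMr// mulrC.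
  have : 2 * (psi n / A) <= eta / 2 * K%:R.
    rewrite mulrA ler_pdivrMr//.
    have h1 : psi n <= (2 * beta + `|p2|) * K%:R.
      have : beta * d <= beta * (K%:R + 1) by rewrite ler_pM2l// ltW.
      have : beta * 1 <= beta * K%:R by rewrite ler_pM2l.
      have : `|p2| * 1 <= `|p2| * K%:R by rewrite ler_wpM2l.
      by rewrite psid; lra.
    have h2 : 4 * (2 * beta + `|p2|) <= eta * A.
      have -> : 4 * (2 * beta + `|p2|) = eta * (4 * (2 * beta + `|p2|) / eta).
        by field; rewrite gt_eqF.
      by rewrite ler_pM2l// /A; lra.
    have : 4 * (2 * beta + `|p2|) * K%:R <= eta * A * K%:R by rewrite ler_pM2r.
    lra.
  lra.
have muphi := periodic_measure_phi K.-1 m0.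
have [ipsi intpsi] := periodic_measure_digit K.-1 m0 psi.
split => //; rewrite intpsi -nE -KE -/p2 !lte_fin.
have -> : p2 + (psi n - p2) / K%:R = alpha + beta * (d - K%:R) / K%:R.
  rewrite psid; have -> : alpha = beta + p2 by rewrite /beta subrK.
  by field; rewrite gt_eqF.
have h0 : 0 <= beta * (d - K%:R) / K%:R by rewrite divr_ge0 ?mulr_ge0 ?subr_ge0// ltW.
have h1 : beta * (d - K%:R) / K%:R < eps.
  rewrite ltr_pdivrMr//; apply: (@lt_le_trans _ _ (beta * 1)).
    by rewrite ltr_pM2l//; lra.
  by rewrite mulr1 mulrC -ler_pdivrMr// ltW.
by apply/andP; split; lra.
Qed.

Lemma rate_admissibleS psi alpha alpha' eps eps' :
  `|alpha - alpha'| <= eps - eps' ->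
  rate_admissible psi alpha' eps' `<=` rate_admissible psi alpha eps.
Proof.
move=> h mu [muP ipsi /andP[lo hi]]; split => //.
move: h; rewrite ler_norml => /andP[h1 h2]; apply/andP; split.
  by apply: le_lt_trans lo; rewrite lee_fin; lra.
by apply: lt_le_trans hi _; rewrite lee_fin; lra.
Qed.

(** At [alpha = psi 2] there is no room for a period, so the orbits are taken for
    [alpha + eps / 2]. *)
Lemma rate_sup_eq0 psi alpha eps :
  limn_esup (fun n => (psi n / ln (n%:R : R))%:E) = +oo%E ->
  psi 2%N <= alpha -> 0 < eps -> rate_sup psi alpha eps = 0%E.
Proof.
move=> psioo alpha2 eps0; apply/eqP; rewrite eq_le; apply/andP; split.
  by apply: ge_ereal_sup => _ [mu [muP _ _] <-]; exact: free_energy_le0.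
apply/lee_addgt0Pr => eta eta0.
have e2 : 0 < eps / 2 by rewrite divr_gt0.
have alpha2' : psi 2%N < alpha + eps / 2 by lra.
have [mu mu_adm chile] := periodic_approximation psioo alpha2' e2 eta0.
have muP : renyi_invariant_phi mu by case: mu_adm.
rewrite -leeBlDr// sub0e.
apply: (@le_trans _ _ (- chi mu)%E); first by rewrite leeN2.
apply: le_trans (free_energy_ge muP) _.
apply: ereal_sup_ubound; exists mu => //.
apply: rate_admissibleS mu_adm; rewrite opprD addNKr normrN ger0_norm; lra.
Qed.

Lemma rate_function_eq0 psi alpha :
  limn_esup (fun n => (psi n / ln (n%:R : R))%:E) = +oo%E ->
  psi 2%N <= alpha -> rate_function psi alpha = 0%E.
Proof.
move=> psioo alpha2; rewrite /rate_function.
rewrite (@lim_near_cst _ _ _ _ _ 0%E) ?oppe0//.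
by near=> eps; apply: rate_sup_eq0 => //; near: eps; exact: nbhs_right_gt.
Unshelve. all: by end_near. Qed.

(** The digit is at most [2 / (1 - x)], and [- phi x = 2 ln (1 / (1 - x))]. *)
Lemma integral_digit_le psi (C D : R) mu : 0 <= C ->
  (forall n, (2 <= n)%N -> psi n <= C * ln n%:R + D) ->
  renyi_invariant_phi mu ->
  mu.-integrable unit_itv (EFin \o (psi \o @b1 R)) ->
  (\int[mu]_(x in unit_itv) (psi (b1 x))%:E <=
   (C * ln 2 + D + C / 2 * fine (chi mu))%:E)%E.
Proof.
move=> C0 psiC muP ipsi; have [[mu1 _] iphi] := muP.
have mI : measurable (unit_itv : set mR) by exact: measurable_itv.
have icst : (\int[mu]_(x in unit_itv) (C * ln 2 + D)%:E = (C * ln 2 + D)%:E)%E.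
  by rewrite integral_cst// -[RHS]mule1; congr (_ * _)%E; exact: mu1.
pose c := C * ln 2 + D.
have Icst : mu.-integrable unit_itv (EFin \o cst c) by exact: finite_measure_integrable_cst.
have Iphi : mu.-integrable unit_itv (fun x : mR => (- (C / 2))%:E * (phi x)%:E)%E.
  exact: integrableZl.
rewrite EFinD EFinM (fineK (chi_fin muP)) -icst.
have -> : ((C / 2)%:E * chi mu = \int[mu]_(x in unit_itv) ((- (C / 2))%:E * (phi x)%:E))%E.
  by rewrite integralZl// /chi muleN EFinN mulNe.
rewrite -(integralD mI Icst Iphi).
apply: le_integral => //; first exact: integrableD.
move=> x /set_mem xI; rewrite -EFinM -EFinD lee_fin.
apply: le_trans (psiC _ (b1_ge2 xI)) _.
have z1 := inv_1sub_ge1 xI; have zE := renyiE xI; have oE := oppr_phi xI.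
have := renyi_unit x; rewrite /= in_itv/= => /andP[T0 T1].
have lnb : ln ((b1 x)%:R : R) <= ln 2 - phi x / 2.
  apply: (@le_trans _ _ (ln (2 * (1 - x)^-1))).
    have b0 : (0 : R) < (b1 x)%:R by rewrite ltr0n; have := b1_ge2 xI; lia.
    by rewrite ler_ln ?posrE//; lra.
  by rewrite lnM ?posrE//; lra.
have := ler_wpM2l C0 lnb; rewrite /c /=; lra.
Qed.

(** For measures with a mean of [psi] near this [alpha] the exponent exceeds
    [12 ln 2 + 4], which makes the free energy at most [-1]. *)
Lemma rate_function_neq0 psi (C D : R) : 0 < C ->
  (forall n, (2 <= n)%N -> psi n <= C * ln n%:R + D) ->
  exists2 alpha, psi 2%N <= alpha & rate_function psi alpha <> 0%E.
Proof.
move=> C0 psiC; exists (Num.max (psi 2%N) (1 + D + C * (7 * ln 2 + 2))).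
  by rewrite le_max lexx.
set alpha := Num.max _ _.
have alpha_ge : 1 + D + C * (7 * ln 2 + 2) <= alpha by rewrite le_max lexx orbT.
have sup_le eps : 0 < eps <= 1 -> (rate_sup psi alpha eps <= (-1)%:E)%E.
  move=> /andP[eps0 eps1]; apply: ge_ereal_sup => _ [mu [muP ipsi /andP[lo _]] <-].
  apply: le_trans (free_energy_le_quarter_chi muP) _; rewrite lee_fin.
  have := lt_le_trans lo (integral_digit_le (ltW C0) psiC muP ipsi).
  rewrite lte_fin => h.
  have : C * (6 * ln 2 + 2) < C * (fine (chi mu) / 2) by lra.
  by rewrite ltr_pM2l//; lra.
rewrite /rate_function => r0.
have : (lim (rate_sup psi alpha eps @[eps --> (0:R)^'+]) <= (-1)%:E)%E.
  apply: lime_le; first exact: is_cvg_rate_sup.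
  near=> eps; apply: sup_le; apply/andP; split.
    by near: eps; exact: nbhs_right_gt.
  by near: eps; exact: nbhs_right_le.
move: r0 => /eqP; rewrite oppe_eq0 => /eqP ->; rewrite lee_fin; lra.
Unshelve. all: by end_near. Qed.

Lemma log_bound_of_limsup_finite psi :
  limn_esup (fun n => (psi n / ln (n%:R : R))%:E) <> +oo%E ->
  exists C D : R, 0 < C /\ forall n, (2 <= n)%N -> psi n <= C * ln n%:R + D.
Proof.
move=> /limn_esup_pinftyP; rewrite -existsNE => -[A]; rewrite -existsNE => -[N HN].
pose C := Num.max A 1; pose D := \sum_(i < N) `|psi i|.
have C1 : 1 <= C by rewrite le_max lexx orbT.
have D0 : 0 <= D by exact: sumr_ge0.
exists C, D; split=> [|n n2]; first lra.
have lnn : 0 < ln (n%:R : R) by rewrite ln_gt0// ltr1n.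
have [Nn|nN] := leqP N n.
  have : psi n <= A * ln n%:R.
    rewrite -ler_pdivrMr// leNgt; apply/negP => h; apply: HN; exists n => //.
  have : A * ln n%:R <= C * ln n%:R by rewrite ler_pM2r// le_max lexx.
  lra.
have : psi n <= D.
  apply: le_trans (ler_norm _) _.
  by rewrite /D (bigD1 (Ordinal nN))//= lerDl sumr_ge0.
have : 0 <= C * ln n%:R by rewrite mulr_ge0 ?(ltW lnn)//; lra.
lra.
Qed.

End RateFunction.

Theorem theoremC (R : realType) (psi : nat -> R)
  (psi_nonconst : exists m n : nat,
     [/\ (2 <= m)%N, (2 <= n)%N & psi m <> psi n])
  (psi_liminf : (0 <= limn_einf (fun n => (psi n)%:E))%E)
  (psi_limsup : limn_esup (fun n => (psi n)%:E) = +oo%E) :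
  (forall alpha : R, psi 2%N <= alpha -> rate_function psi alpha = 0%E) <->
  limn_esup (fun n => (psi n / ln (n%:R : R))%:E) = +oo%E.
Proof.
split=> [rate0|psioo alpha]; last exact: rate_function_eq0.
apply: contrapT => /log_bound_of_limsup_finite[C [D [C0 psiC]]].
have [alpha alpha2] := rate_function_neq0 C0 psiC.
by rewrite rate0.
Qed.
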